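(* Let $k\ge2$ be fixed, $k_X=\lfloor k/2\rfloor$, $k_Y=\lceil k/2\rceil$, and let $n\to\infty$ range over multiples of $k$. Let $p=p(n)$ and $\epsilon=\epsilon(n)$ satisfy $\epsilon\to0$ and $\epsilon n^{1/2}p^2/\log^5n\to\infty$. Let $H=([n],\mathcal E)$ be a $k$-uniform hypergraph with $m$ edges, $p=m/\binom nk$, satisfying: (R_a) $d_H(S)\ge\lceil(1-\epsilon)\binom{n-k_X}{k_Y}p\rceil$ for all $S\in\binom{[n]}{k_X}$; (R_b) $d_H(S)\ge\lceil(1-\epsilon)\binom{n-k_Y}{k_X}p\rceil$ for all $S\in\binom{[n]}{k_Y}$; (R_c) $d_H(S)\le\lceil(1+\epsilon)\binom{n-k_X-1}{k_Y-1}p\rceil$ for all $S\in\binom{[n]}{k_X+1}$; (R_d) $d_H(S)\le\lceil(1+\epsilon)\binom{n-k_Y-1}{k_X-1}p\rceil$ for all $S\in\binom{[n]}{k_Y+1}$; (R_e) $|N_H(S_1)\cap N_H(S_2)|\le\lfloor(1+\epsilon)\binom{n-2k_X}{k_Y}p^2\rfloor$ for all disjoint $S_1,S_2\in\binom{[n]}{k_X}$; (R_f) $|N_H(S_1)\cap N_H(S_2)|\le\lfloor(1+\epsilon)\binom{n-2k_Y}{k_X}p^2\rfloor$ for all disjoint $S_1,S_2\in\binom{[n]}{k_Y}$. Then, for $n$ sufficiently large, $H$ contains at least $(1-4\epsilon^{1/3})m/\nu_k$ pairwise edge-disjoint perfect matchings, where $\nu_k=n/k$.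
   Context: For a $k$-uniform hypergraph $H=([n],\mathcal E)$ and $X\subseteq[n]$ with $|X|=a<k$, $N_H(X)=\{Y\in\binom{[n]}{k-a}: X\cup Y\in\mathcal E\}$ and $d_H(X)=|N_H(X)|$. A perfect matching is a set of $n/k$ pairwise disjoint edges covering $[n]$. *)

(* Defs.v *)
From mathcomp Require Import all_boot.
From Stdlib Require Import Reals ZArith.
Set Implicit Arguments. Unset Strict Implicit. Unset Printing Implicit Defensive.

Definition Rfloor (x : R) : Z := Int_part x.
Definition Rceil (x : R) : Z := (- Int_part (- x))%Z.

Definition uniform (n k : nat) (E : {set {set 'I_n}}) : Prop :=
  forall e, e \in E -> #|e| = k.

Definition nbhd (n k : nat) (E : {set {set 'I_n}}) (X : {set 'I_n})
  : {set {set 'I_n}} :=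
  [set Y : {set 'I_n} | (#|Y| == k - #|X|) && (X :|: Y \in E)].

Definition deg (n k : nat) (E : {set {set 'I_n}}) (X : {set 'I_n}) : nat :=
  #|nbhd k E X|.

Definition perfect_matching (n k : nat) (E M : {set {set 'I_n}}) : Prop :=
  M \subset E /\ #|M| = n %/ k /\
  (forall e f, e \in M -> f \in M -> e != f -> [disjoint e & f]) /\
  cover M = [set: 'I_n].

Definition cv0_mult (k : nat) (u : nat -> R) : Prop :=
  forall d : R, (0 < d)%R ->
    exists N0 : nat, forall n : nat, leq N0 n -> (k %| n) -> (Rabs (u n) < d)%R.
Definition cvinf_mult (k : nat) (u : nat -> R) : Prop :=
  forall M : R, exists N0 : nat, forall n : nat, leq N0 n -> (k %| n) -> (M < u n)%R.

(* Main.v *)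
Require Import Defs.
From Stdlib Require Import Reals ZArith.
From mathcomp Require Import all_boot all_order all_algebra all_fingroup.
From mathcomp Require Import Rstruct.
From mathcomp Require Import zify ring lra.
Set Implicit Arguments. Unset Strict Implicit. Unset Printing Implicit Defensive.
Import Order.TTheory GRing.Theory Num.Theory.
Bind Scope ring_scope with R.
Local Arguments exp : clear scopes.

(** Split the vertex set by a random permutation into nu blocks X_i of size
    floor(k/2) and nu blocks Y_j of size ceil(k/2), and let B be the bipartite
    graph of the pairs (i, j) such that X_i + Y_j is an edge of H. Conditions
    (R_a), (R_b), (R_e) and the concentration of Lipschitz functions of a random
    permutation make all degrees of B at least about p nu and all codegrees of
    the X-side at most about p^2 nu. Every edge of H lies in B with probability
    q = nu^2 / C(n, k); by a multiplicative weights argument one can choose about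
    L / q good permutations whose graphs cover every edge of H at most L times.
    Giving every edge to one of the at most L graphs that contain it, uniformly
    at random, splits H into bipartite graphs with degrees about D = p nu / L and
    codegrees about D^2 / nu. By an expander-mixing estimate each of them
    satisfies the cut condition e(A, B) >= r (|A| + |B| - nu) for some
    r = (1 - O(eta)) D, hence contains r disjoint perfect matchings.
    All relative errors are multiples of eta = eps^(1/3) / 50, and together they
    cost at most a proportion 173 eta of the edges. *)

(** * Regular factors of bipartite graphs *)

(** The cube root comes from the splitting step. Controlling the weights of up to n^k edges forces L
    to be of order log n / eta^2, so the codegrees after splitting are only of order p^2 nu / L^2;
    keeping them within a factor 1 + O(eta) with failure probability n^(-O(k)) needs eta^6 p^2 n >>
    log^3 n. Codegrees in the graph of a random permutation need eta^2 p^4 n >> log n, by bounded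
    differences. The squared growth hypothesis, eps^2 n p^4 >> log^10 n, gives both once eta^6 is of
    order eps^2. Edges may be covered unequally often. Each edge draws one of L + 1 slots, and a
    slot that no graph occupies discards the edge; so it survives in each graph containing it with
    probability exactly 1 / (L + 1), whatever its multiplicity. Little is lost, because the number N
    of graphs has N q close to L. The count balances: (L / q) (p nu / L) = p nu / q = m / nu.
    Constants, in units of eta: 24 * 7 = 168 from the cut condition, one from rounding r, four from
    N; the claim allows 4 * 50 = 200. *)

Definition bip_edges (V : finType) (G : {set V * V}) (A B : {set V}) : nat :=
  \sum_(p in G) ((p.1 \in A) && (p.2 \in B)).

Definition bip_regular (V : finType) (r : nat) (G : {set V * V}) : Prop :=
  (forall x, bip_edges G [set x] setT = r) /\
  (forall y, bip_edges G setT [set y] = r).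

Lemma bip_edges_suml (V : finType) (G : {set V * V}) A B :
  bip_edges G A B = \sum_(x in A) bip_edges G [set x] B.
Proof.
rewrite /bip_edges exchange_big /=; apply: eq_bigr => -[x y] _ /=.
have [xA|xA] := boolP (x \in A).
  rewrite (bigD1 x) //= set11 /= big1 ?addn0 // => z /andP[_ zx].
  by rewrite inE eq_sym (negbTE zx).
rewrite big1 // => z zA; rewrite inE.
by case: eqP xA => // ->; rewrite zA.
Qed.

Lemma bip_edges_sumr (V : finType) (G : {set V * V}) A B :
  bip_edges G A B = \sum_(y in B) bip_edges G A [set y].
Proof.
rewrite /bip_edges exchange_big /=; apply: eq_bigr => -[x y] _ /=.
have [yB|yB] := boolP (y \in B).
  rewrite (bigD1 y) //= set11 /= big1 ?addn0 // => z /andP[_ zy].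
  by rewrite inE (eq_sym y) (negbTE zy) andbF.
rewrite andbF big1 // => z zB; rewrite inE andbC.
by case: eqP yB => // ->; rewrite zB.
Qed.

Lemma bip_edgesC (V : finType) (G : {set V * V}) A B :
  bip_edges G A setT = bip_edges G A B + bip_edges G A (~: B).
Proof.
rewrite /bip_edges -big_split /=; apply: eq_bigr => -[x y] _ /=.
by rewrite !inE; case: (x \in A); case: (y \in B).
Qed.

(** True edge by edge. Sizes are modular, so tight pairs of the cut condition stay tight under this
    crossed meet and join. *)
Lemma bip_edges_submod (V : finType) (G : {set V * V}) A B A' B' :
  bip_edges G (A :&: A') (B :|: B') + bip_edges G (A :|: A') (B :&: B')
    <= bip_edges G A B + bip_edges G A' B'.
Proof.
rewrite /bip_edges -!big_split /=; apply: leq_sum => -[x y] _ /=.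
by rewrite !inE; do 4 case: (_ \in _).
Qed.

(** Max-flow min-cut criterion for an [r]-factor between two copies of [V]. The term [r *
    #|[set: V]|] is added on the right because subtraction on [nat] truncates. *)
Definition bip_cond (V : finType) (r : nat) (G : {set V * V}) : bool :=
  [forall A : {set V}, [forall B : {set V},
    r * (#|A| + #|B|) <= bip_edges G A B + r * #|[set: V]|]].

Lemma bip_condP (V : finType) r (G : {set V * V}) :
  reflect (forall A B : {set V}, r * (#|A| + #|B|) <= bip_edges G A B + r * #|[set: V]|)
          (bip_cond r G).
Proof.
apply: (iffP forallP) => [h A B | h A]; first by move/forallP: (h A); apply.
by apply/forallP.
Qed.

(* In an inclusion-minimal graph satisfying the condition every edge lies in a
   tight pair; by submodularity the tight pairs of the edges at x merge into one
   tight pair (A, B) with x in A and N(x) inside B, and removing x from A then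
   shows that x has degree at most r. *)
Lemma bip_cond_factor (V : finType) r (G : {set V * V}) :
  bip_cond r G -> exists2 G' : {set V * V}, G' \subset G & bip_regular r G'.
Proof.
move=> /minset_exists[H /minsetP[/bip_condP Hc Hmin] HG]; exists H => //.
pose tight (A B : {set V}) := r * (#|A| + #|B|) == bip_edges H A B + r * #|[set: V]|.
have tight_merge A B A' B' : tight A B -> tight A' B' -> tight (A :&: A') (B :|: B').
  rewrite /tight => /eqP t1 /eqP t2.
  have c1 := Hc (A :&: A') (B :|: B'); have c2 := Hc (A :|: A') (B :&: B').
  have s := bip_edges_submod H A B A' B'.
  have cA := cardsUI A A'; have cB := cardsUI B B'.
  have e : r * (#|A :&: A'| + #|B :|: B'|) + r * (#|A :|: A'| + #|B :&: B'|)
       = r * (#|A| + #|B|) + r * (#|A'| + #|B'|).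
    by rewrite -!mulnDr; congr (_ * _); lia.
  lia.
have edge_tight x y : (x, y) \in H ->
    exists A B : {set V}, [/\ x \in A, y \in B & tight A B].
  move=> xyH.
  have [A [B lt]] : exists A B : {set V},
      bip_edges (H :\ (x, y)) A B + r * #|[set: V]| < r * (#|A| + #|B|).
    have : ~~ bip_cond r (H :\ (x, y)).
      apply/negP => hc; have := Hmin _ hc (subD1set _ _) => e.
      by move: xyH; rewrite -e !inE eqxx.
    by case/forallPn => A /forallPn[B]; rewrite -ltnNge; exists A, B.
  (* Deleting the edge lowers the count by at most one, and only if the edge lies between [A] and
     [B]; so the pair violated after the deletion was tight before and contains the edge. *)
  have split_e : bip_edges H A B
      = ((x \in A) && (y \in B)) + bip_edges (H :\ (x, y)) A B.
    by rewrite {1}/bip_edges (big_setD1 _ xyH).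
  have := Hc A B; rewrite split_e.
  have [xA|xA] := boolP (x \in A); have [yB|yB] := boolP (y \in B); move=> /= ge; try lia.
  by exists A, B; split => //; apply/eqP; rewrite split_e xA yB /=; lia.
have degle x : bip_edges H [set x] setT <= r.
  have nb_tight (s : seq V) : {in s, forall y, (x, y) \in H} ->
      exists A B : {set V}, [/\ x \in A, {in s, forall y, y \in B} & tight A B].
    elim: s => [_|y s IH hs].
      exists setT, set0; split => //.
      rewrite /tight cards0 addn0 /bip_edges big1 // => p _.
      by rewrite !inE andbF.
    have [|A [B [xA sB tAB]]] := IH; first by move=> z zs; apply: hs; rewrite inE zs orbT.
    have [|A' [B' [xA' yB' tAB']]] := @edge_tight x y; first by apply: hs; rewrite inE eqxx.
    exists (A :&: A'), (B :|: B'); split; [by rewrite inE xA | | exact: tight_merge].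
    by move=> z; rewrite !inE => /orP[/eqP->|/sB ->]; rewrite ?yB' ?orbT.
  have [y|A [B [xA NB /eqP tAB]]] := nb_tight [seq y <- enum V | (x, y) \in H].
    by rewrite mem_filter => /andP[].
  have := Hc (A :\ x) B; have := cardsD1 x A; rewrite xA => cA.
  have eAB : bip_edges H A B = bip_edges H [set x] setT + bip_edges H (A :\ x) B.
    rewrite /bip_edges -big_split /=; apply: eq_bigr => -[u v] uvH /=.
    rewrite !inE andbT; case: eqVneq => [ux|_] //=; rewrite {}ux in uvH *.
    by rewrite xA NB // mem_filter uvH mem_enum.
  move: tAB; rewrite eAB cA -addnA mulnDr muln1; lia.
have degx x : bip_edges H [set x] setT = r.
  apply/eqP; rewrite eqn_leq degle /=.
  by have := Hc [set x] setT; rewrite cards1 mulnDr muln1; lia.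
have degge y : r <= bip_edges H setT [set y].
  by have := Hc setT [set y]; rewrite cards1 mulnDr muln1; lia.
split => // y; apply/eqP; rewrite eqn_leq degge andbT.
(* Right degrees are at least [r], and the left degrees fix their total at [r] times [#|V|]; so none
   can exceed [r]. *)
have tot : \sum_y bip_edges H setT [set y] = \sum_(y : V) r.
  transitivity (bip_edges H setT setT).
    by rewrite (bip_edges_sumr _ _ setT); apply: eq_bigl => z; rewrite inE.
  by rewrite bip_edges_suml; apply: eq_big => [z|z _]; rewrite ?inE ?degx.
rewrite leqNgt; apply/negP => lt.
move: tot; rewrite (bigD1 y) //= [RHS](bigD1 y) //= => tot.
have : \sum_(i | i != y) r <= \sum_(i | i != y) bip_edges H setT [set i].
  by apply: leq_sum => i _.
lia.
Qed.

Lemma bip_edges_disjointU (V : finType) (G M : {set V * V}) A B :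
  M \subset G -> bip_edges G A B = bip_edges M A B + bip_edges (G :\: M) A B.
Proof. by move=> sMG; rewrite /bip_edges (big_setID M) /= (setIidPr sMG). Qed.

(** Of the [r * #|A|] edges leaving [A], at most [r * #|~: B|] can miss [B]. *)
Lemma bip_regular_cond (V : finType) r (G : {set V * V}) :
  bip_regular r G -> bip_cond r G.
Proof.
move=> [dx dy]; apply/bip_condP => A B.
have eA : bip_edges G A setT = r * #|A|.
  by rewrite bip_edges_suml (eq_bigr (fun=> r)) ?sum_nat_const 1?mulnC // => x _; rewrite dx.
have eB : bip_edges G setT (~: B) = r * #|~: B|.
  by rewrite bip_edges_sumr (eq_bigr (fun=> r)) ?sum_nat_const 1?mulnC // => x _; rewrite dy.
have le : bip_edges G A (~: B) <= bip_edges G setT (~: B).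
  by apply: leq_sum => p _; rewrite !inE; case: (_ \in A) => //=; case: (_ \in _).
have eC := bip_edgesC G A B; rewrite [#|[set: V]|]cardsT -(cardsC B) !mulnDr.
by lia.
Qed.

(** The condition asks for [r] times the excess of [#|A| + #|B|] over [#|[set: V]|], and for nothing
    without excess, so it is monotone in [r]. *)
Lemma bip_cond_le (V : finType) r r' (G : {set V * V}) :
  r' <= r -> bip_cond r G -> bip_cond r' G.
Proof.
move=> r'r /bip_condP h; apply/bip_condP => A B.
have := h A B; have [le|lt] := leqP (#|A| + #|B|) #|[set: V]|.
  move=> _; apply: leq_trans (leq_addl _ _); by rewrite leq_mul2l le orbT.
rewrite -(subnK (ltnW lt)) !mulnDr !leq_add2r; apply: leq_trans.
by rewrite leq_mul2r r'r orbT.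
Qed.

(** König's decomposition by peeling: a regular graph of positive degree satisfies the condition for
    1, hence contains a perfect matching, and removing it leaves a regular graph. *)
Lemma bip_disjoint_matchings (V : finType) r (G : {set V * V}) :
  bip_cond r G -> exists M : nat -> {set V * V},
    (forall i, i < r -> M i \subset G /\ bip_regular 1 (M i)) /\
    (forall i j, i < j -> j < r -> [disjoint M i & M j]).
Proof.
move=> /bip_cond_factor[G' sG' regG'].
suff [M [M1 M2]] : exists M : nat -> {set V * V},
    (forall i, i < r -> M i \subset G' /\ bip_regular 1 (M i)) /\
    (forall i j, i < j -> j < r -> [disjoint M i & M j]).
  exists M; split => // i ir; have [h1 h2] := M1 i ir.
  by split => //; apply: subset_trans sG'.
elim: r G' {G sG'} regG' => [|r IH] G regG; first by exists (fun=> set0).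
have [M0 sM0 [M0x M0y]] := bip_cond_factor (bip_cond_le (ltn0Sn r) (bip_regular_cond regG)).
have [|M [M1 M2]] := IH (G :\: M0).
  case: regG => dx dy; split => x.
    by have := dx x; rewrite (bip_edges_disjointU _ _ sM0) M0x add1n => -[].
  by have := dy x; rewrite (bip_edges_disjointU _ _ sM0) M0y add1n => -[].
exists (fun i => if i == r then M0 else M i); split => [i | i j ij].
  rewrite ltnS leq_eqVlt; case: eqP => [_ _|_ /= ir]; first by [].
  by have [h1 h2] := M1 i ir; split => //; apply: subset_trans h1 (subsetDl _ _).
rewrite ltnS leq_eqVlt; case: (eqVneq j r) => [jr _|jr /= lt].
  have ir : i < r by rewrite -jr.
  by rewrite ltn_eqF //; have [/subsetDP[_ h] _] := M1 i ir.
by rewrite ltn_eqF ?(ltn_trans ij) //; apply: M2.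
Qed.

(** * Expander mixing from codegrees *)

Section MixingArith.
Local Open Scope ring_scope.
Variable F : realFieldType.

(** Dictionary for the three cases: [W] is [D * nu], [u] is [1 / D], [x] and [y] are the relative
    sizes of the complements of [A] and [B], and [e] counts the edges from [A] to [B]. Here the
    error is a bounded multiple of [al], and [1 - x - y >= 1 / 4] makes the allowance at least
    [6 * al]. *)
Lemma mixing_arith_large (al u x y W e f h : F) :
  0 < al -> u <= al / 200 -> 0 <= x -> 0 <= y -> x <= 1 -> 0 <= W ->
  1 / 4 <= 1 - x - y ->
  (1 - al) * (1 - x) * W <= e + f ->
  f + h <= (1 + al) * W - (1 - al) * (1 - y) * W ->
  W * (x * y - (x * y / 2 + u + 3 / 2 * (al * x))) <= h ->
  (1 - 24 * al) * (1 - x - y) * W <= e.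
Proof.
move=> al0 u_al x0 y0 x1 W0 big degA tot dis.
have h1 : 0 <= al * (1 - x - y - 1 / 4) by rewrite mulr_ge0 ?(ltW al0) // subr_ge0.
have h2 : 0 <= x * y by apply: mulr_ge0.
have h3 : 0 <= al * x by rewrite mulr_ge0 // ltW.
have h4 : 0 <= al * y by rewrite mulr_ge0 // ltW.
have h5 : 0 <= al * (1 - x) by rewrite mulr_ge0 ?(ltW al0) // subr_ge0.
have : 0 <= (24 * (al * (1 - x - y)) + x * y / 2 - u - 3 / 2 * (al * x)
    - al * (3 - x - y)) * W by apply: mulr_ge0 => //; lra.
by move: degA tot dis; clear; lra.
Qed.

(** [(1 - x) * (1 - y)] exceeds [1 - x - y] by [x * y], of which the discrepancy takes half. The
    errors are multiples of [al * (1 - x)], that is [al * (1 - x - y) + al * y]: the first part is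
    allowed, the second is below the remaining [x * y / 2] since [x >= 3 / 8]. *)
Lemma mixing_arith_left (al u x y W e f : F) :
  0 < al -> al <= 1 / 200 -> 0 < u -> u <= al / 200 -> 3 / 8 <= x -> x <= 1 ->
  0 <= y -> 0 <= W ->
  (1 - al) * (1 - x) * W <= e + f ->
  f - W * ((1 - x) * y)
    <= W * (x * y / 2 + (1 - x) * u / x + 3 * al * (1 - x) ^+ 2 / (2 * x)) ->
  (1 - 24 * al) * (1 - x - y) * W <= e.
Proof.
move=> al0 al1 u0 u_al x38 x1 y0 W0 degA dis.
have xp : 0 < x by lra.
have x10 : 0 <= 1 - x by lra.
have x380 : 0 <= x - 3 / 8 by lra.
have e1 : (1 - x) * u / x <= 8 / 3 * ((1 - x) * u).
  rewrite ler_pdivrMr //.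
  have : 0 <= (1 - x) * u * (x - 3 / 8) by rewrite !mulr_ge0 // ltW.
  by clear; lra.
have e2 : 3 * al * (1 - x) ^+ 2 / (2 * x) <= 4 * (al * (1 - x)).
  rewrite ler_pdivrMr ?mulr_gt0 //.
  have : 0 <= al * (1 - x) * (x - 3 / 8) by rewrite !mulr_ge0 // ltW.
  have : 0 <= al * (1 - x) * x by rewrite !mulr_ge0 // ltW.
  by rewrite expr2; clear; lra.
have h3 : 0 <= y * (x - 3 / 8) by apply: mulr_ge0.
have h4 : 0 <= y * (1 / 200 - al) by rewrite mulr_ge0 // subr_ge0.
have h5 : 0 <= (1 - x) * (al / 200 - u) by rewrite mulr_ge0 // subr_ge0.
have h6 : 0 <= al * (1 - x) by rewrite mulr_ge0 // ltW.
have : 0 <= (x * y / 2 + 24 * (al * (1 - x - y)) - al * (1 - x) -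
    (1 - x) * u / x - 3 * al * (1 - x) ^+ 2 / (2 * x)) * W.
  by apply: mulr_ge0 => //; move: e1 e2 h3 h4 h5 h6 y0; clear; lra.
by move: degA dis; clear; lra.
Qed.

(** [v] stands for [1 / (4 * al * D)]. The surplus [x * y] pays for [3 / 8 * x ^+ 2] because
    [x <= y], and for [x * v] because [y >= 3 / 8]. *)
Lemma mixing_arith_right (al v x y W e f : F) :
  0 < al -> al <= 1 / 200 -> v <= 1 / 800 -> 0 <= x -> x <= y -> 3 / 8 <= y ->
  y <= 1 -> 0 <= W ->
  (1 - al) * (1 - y) * W <= e + f ->
  f - W * (x * (1 - y)) <= W * (2 * (al * (1 - y)) + x * v + 3 / 8 * x ^+ 2) ->
  (1 - 24 * al) * (1 - x - y) * W <= e.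
Proof.
move=> al0 al1 v1 x0 xy y38 y1 W0 degB dis.
have h3 : 0 <= x * (y - 3 / 8) by rewrite mulr_ge0 // subr_ge0.
have h4 : 0 <= x * (1 / 200 - al) by rewrite mulr_ge0 // subr_ge0.
have h5 : 0 <= x * (y - x) by rewrite mulr_ge0 // subr_ge0.
have h6 : 0 <= al * (1 - y) by rewrite mulr_ge0 ?subr_ge0 ?(ltW al0).
have h7 : 0 <= x * (1 / 800 - v) by rewrite mulr_ge0 // subr_ge0.
have : 0 <= (x * y + 24 * (al * (1 - x - y)) - 3 * (al * (1 - y)) -
    x * v - 3 / 8 * x ^+ 2) * W.
  by apply: mulr_ge0 => //; move: h3 h4 h5 h6 h7 x0; rewrite expr2; clear; lra.
by move: degB dis; clear; lra.
Qed.
End MixingArith.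

(** * Second moments of the degrees into a set, and the cut condition *)

Section Mixing.
Local Open Scope ring_scope.
Variables (F : realFieldType) (V : finType) (G : {set V * V}).

Let g (x y : V) : F := ((x, y) \in G)%:R.

Definition bip_codeg (x x' : V) : nat :=
  #|[set y | ((x, y) \in G) && ((x', y) \in G)]|.

Let degs (S : {set V}) (y : V) : F := \sum_(x in S) g x y.

Lemma bip_edgesE (A B : {set V}) :
  (bip_edges G A B)%:R = \sum_(y in B) \sum_(x in A) ((x, y) \in G)%:R :> F.
Proof.
rewrite exchange_big /= pair_big /= /bip_edges natr_sum [LHS]big_mkcond [RHS]big_mkcond /=.
apply: eq_bigr => -[x y] _ /=.
by case: ((x, y) \in G); case: (x \in A); case: (y \in B).
Qed.

Variables (D al : F).
Let nu : F := #|[set: V]|%:R.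
Hypothesis nu_gt0 : 0 < nu.
Hypothesis al_gt0 : 0 < al.
Hypothesis al_small : al <= 1 / 200.
Hypothesis D_large : 1 <= D * al ^+ 2.
Hypothesis deg_l : forall x, (1 - al) * D <= (bip_edges G [set x] setT)%:R.
Hypothesis deg_r : forall y, (1 - al) * D <= (bip_edges G setT [set y])%:R.
Hypothesis codeg : forall x x', x != x' ->
  (bip_codeg x x')%:R <= (1 + al) * D ^+ 2 / nu.

Let D_gt : 200 <= al * D.
Proof.
have [[[nu0 al0] al1] DL] := (nu_gt0, al_gt0, al_small, D_large).
have D0 : 0 < D.
  by rewrite -(pmulr_lgt0 _ (exprn_gt0 2 al_gt0)); apply: lt_le_trans D_large.
have : 0 <= (1 / 200 - al) * (al * D) by apply: mulr_ge0; [lra | apply: mulr_ge0; lra].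
by move: D_large; rewrite expr2; lra.
Qed.

Let D_gt0 : 0 < D.
Proof. by rewrite -(pmulr_rgt0 _ al_gt0); apply: lt_le_trans D_gt; lra. Qed.

Let nuE : nu = \sum_(y : V) 1.
Proof. by rewrite /nu cardsT sumr_const. Qed.

Let sum_degs S : \sum_y degs S y = \sum_(x in S) (bip_edges G [set x] setT)%:R.
Proof.
rewrite /degs exchange_big /=; apply: eq_bigr => x _; rewrite bip_edgesE.
by apply: eq_big => [y|y _]; rewrite ?inE // big_set1.
Qed.

Let codegE x x' : (bip_codeg x x')%:R = \sum_y g x y * g x' y.
Proof.
rewrite /bip_codeg cardsE -sum1_card natr_sum big_mkcond /=.
by apply: eq_bigr => y _; rewrite /g unfold_in; case: (_ \in G); case: (_ \in G); rewrite ?mulr1 ?mulr0.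
Qed.

(* Counting the paths of length two from x, the lower bound on the degrees of the
   right side turns the codegree bound into a bound on the degree of x. *)
Let deg_max x : (bip_edges G [set x] setT)%:R <= 2 * D.
Proof.
have [[[[nu0 al0] al1] DL] D0] := (nu_gt0, al_gt0, al_small, D_large, D_gt0).
have DG := D_gt.
set d := _%:R.
have dE : d = \sum_y g x y.
  by rewrite /d bip_edgesE; apply: eq_big => [y|y _]; rewrite ?inE // big_set1.
have h1 : d * ((1 - al) * D) <= \sum_y g x y * \sum_x' g x' y.
  rewrite dE mulr_suml; apply: ler_sum => y _; apply: ler_wpM2l; first exact: ler0n.
  apply: le_trans (deg_r y) _; rewrite bip_edgesE big_set1.
  by rewrite le_eqVlt; apply/orP; left; apply/eqP; apply: eq_bigl => z; rewrite inE.
have h2 : \sum_y g x y * \sum_x' g x' y <= d + (1 + al) * D ^+ 2.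
  under eq_bigr do rewrite mulr_sumr.
  rewrite exchange_big /= (bigD1 x) //= lerD //.
    by rewrite dE le_eqVlt; apply/orP; left; apply/eqP; apply: eq_bigr => y _;
       rewrite /g -natrM mulnb andbb.
  apply: (@le_trans _ _ (\sum_(i : V) (1 + al) * D ^+ 2 / nu)).
    rewrite [leRHS](bigD1 x) //= -[leLHS]add0r lerD //.
      by rewrite divr_ge0 ?mulr_ge0 ?sqr_ge0 //; lra.
    by apply: ler_sum => z zx; rewrite -codegE codeg // eq_sym.
  rewrite -[X in X <= _]mulr1 -[X in _ * X]mulr1 sumr_const -cardsT -/nu.
  rewrite -[_ *+ _]mulr_natr -/nu !mulr1 mulfVK //; lra.
have d0 : 0 <= d by apply: ler0n.
rewrite -(ler_pM2r D_gt0).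
have : 0 <= d * ((1 / 10 - al) * D - 1 + D / 10) by apply: mulr_ge0; nra.
by move: h1 h2; rewrite expr2; nra.
Qed.

Let sq_degs (S : {set V}) (s : F := #|S|%:R) :
  \sum_y (degs S y) ^+ 2 <=
    \sum_(x in S) (bip_edges G [set x] setT)%:R + s ^+ 2 * ((1 + al) * D ^+ 2 / nu).
Proof.
have [[[[nu0 al0] al1] DL] D0] := (nu_gt0, al_gt0, al_small, D_large, D_gt0).
have -> : \sum_y (degs S y) ^+ 2 = \sum_(x in S) \sum_(x' in S) \sum_y g x y * g x' y.
  under [RHS]eq_bigr do rewrite exchange_big /=.
  rewrite exchange_big /=; apply: eq_bigr => y _; rewrite expr2 /degs mulr_suml.
  by apply: eq_bigr => x _; rewrite mulr_sumr.
have -> : s ^+ 2 * ((1 + al) * D ^+ 2 / nu) = \sum_(x in S) s * ((1 + al) * D ^+ 2 / nu).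
  by rewrite sumr_const -mulr_natr -/s; ring.
rewrite -big_split; apply: ler_sum => x xS; rewrite (bigD1 x) //= lerD //.
  rewrite bip_edgesE le_eqVlt; apply/orP; left; apply/eqP.
  by apply: eq_big => [y|y _]; rewrite ?inE // big_set1 /g -natrM mulnb andbb.
have -> : s * ((1 + al) * D ^+ 2 / nu) = \sum_(x' in S) (1 + al) * D ^+ 2 / nu.
  by rewrite sumr_const -mulr_natr -/s mulrC.
rewrite [leRHS](bigD1 x) //= -[leLHS]add0r lerD //.
  by rewrite divr_ge0 ?mulr_ge0 ?sqr_ge0 //; lra.
by apply: ler_sum => z /andP[_ zx]; rewrite -codegE codeg // eq_sym.
Qed.

(** After expanding the square, [s ^+ 2 * D ^+ 2 / nu] occurs with coefficients [1 + al],
    [- 2 * (1 - al)] and [1], which leaves [3 * al]; the diagonal costs [2 * D * s] by the degree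
    bound. *)
Let var (S : {set V}) (s : F := #|S|%:R) :
  \sum_y (degs S y - D * (s / nu)) ^+ 2 <= 2 * D * s + 3 * al * s ^+ 2 * D ^+ 2 / nu.
Proof.
have [[[[nu0 al0] al1] DL] D0] := (nu_gt0, al_gt0, al_small, D_large, D_gt0).
have DG := D_gt.
have s0 : 0 <= s by apply: ler0n.
have sq : \sum_y (degs S y) ^+ 2 <= 2 * D * s + s ^+ 2 * ((1 + al) * D ^+ 2 / nu).
  apply: le_trans (sq_degs S) _; rewrite lerD2r mulr_natr -sumr_const.
  exact: ler_sum.
have lin : s * ((1 - al) * D) <= \sum_y degs S y.
  rewrite sum_degs mulrC mulr_natr -sumr_const; exact: ler_sum.
have -> : \sum_y (degs S y - D * (s / nu)) ^+ 2 =
    \sum_y (degs S y) ^+ 2 - 2 * (D * (s / nu)) * (\sum_y degs S y)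
      + nu * (D * (s / nu)) ^+ 2.
  rewrite nuE mulr_sumr -sumrN mulr_suml -!big_split /=.
  by apply: eq_bigr => y _; ring.
have c0 : 0 <= D * (s / nu) by rewrite mulr_ge0 ?divr_ge0 //; lra.
have l2 := ler_wpM2l c0 lin.
have e1 : D * (s / nu) * (s * ((1 - al) * D)) = (1 - al) * (s ^+ 2 * D ^+ 2 / nu) by field; lra.
have e2 : nu * (D * (s / nu)) ^+ 2 = s ^+ 2 * D ^+ 2 / nu by field; lra.
have e3 : s ^+ 2 * ((1 + al) * D ^+ 2 / nu) = (1 + al) * (s ^+ 2 * D ^+ 2 / nu) by ring.
have -> : 3 * al * s ^+ 2 * D ^+ 2 / nu = 3 * al * (s ^+ 2 * D ^+ 2 / nu) by ring.
by move: l2 sq; rewrite e1 e2 e3; lra.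
Qed.

(** The estimate [|w| <= ga * D / 2 + w ^+ 2 / (2 * (ga * D))] replaces Cauchy-Schwarz: no square
    root appears, and [ga] can be tuned to each case. *)
Lemma bip_discrepancy (S B : {set V}) (ga : F) (x := #|S|%:R / nu) (z := #|B|%:R / nu) :
  0 < ga ->
  `|(bip_edges G S B)%:R - D * nu * (x * z)|
    <= D * nu * (ga * z / 2 + x / (ga * D) + 3 * al * x ^+ 2 / (2 * ga)).
Proof.
have [[[[nu0 al0] al1] DL] D0] := (nu_gt0, al_gt0, al_small, D_large, D_gt0).
move=> ga0.
have -> : (bip_edges G S B)%:R - D * nu * (x * z) = \sum_(y in B) (degs S y - D * x).
  by rewrite big_split /= sumr_const -mulr_natr bip_edgesE /x /z -/(degs S); field; lra.
apply: (le_trans (ler_norm_sum _ _ _)).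
have k0 : 0 < ga * D by apply: mulr_gt0.
have step (w : F) : `|w| <= ga * D / 2 + w ^+ 2 / (2 * (ga * D)).
  rewrite -(ler_pM2l (mulr_gt0 (ltr0n F 2) k0)) mulrDr mulrCA [X in _ + X]mulrCA divff; last by lra.
  rewrite mulr1; have := sqr_ge0 (`|w| - ga * D); rewrite sqrrB real_normK ?num_real //.
  by rewrite !expr2; lra.
have {}step : \sum_(y in B) `|degs S y - D * x| <=
    \sum_(y in B) (ga * D / 2 + (degs S y - D * x) ^+ 2 / (2 * (ga * D))).
  by apply: ler_sum => y _; apply: step.
apply: (le_trans step).
rewrite big_split /= sumr_const -[_ *+ #|_|]mulr_natr -mulr_suml.
have ext : \sum_(y in B) (degs S y - D * x) ^+ 2 <= \sum_y (degs S y - D * x) ^+ 2.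
  by rewrite [leRHS](bigID (mem B)) /= lerDl; apply: sumr_ge0 => y _; apply: sqr_ge0.
have h : (\sum_(y in B) (degs S y - D * x) ^+ 2) / (2 * (ga * D)) <=
    (2 * D * #|S|%:R + 3 * al * #|S|%:R ^+ 2 * D ^+ 2 / nu) / (2 * (ga * D)).
  by rewrite ler_pM2r ?invr_gt0 ?(le_trans ext (var S)) //; lra.
rewrite -(lerD2l (ga * D / 2 * #|B|%:R)) in h; apply: (le_trans h).
rewrite le_eqVlt; apply/orP; left; apply/eqP; rewrite /x /z; field.
by rewrite !lt0r_neq0.
Qed.

(** The sum of [(degs setT y - D) ^+ 2] is nonnegative and the codegrees bound its quadratic part,
    so [(2 * D - 1) * e <= (2 + al) * D ^+ 2 * nu]; then [al * D] being large suffices. *)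
Let total_edges : (bip_edges G setT setT)%:R <= (1 + al) * (D * nu).
Proof.
have [[[[nu0 al0] al1] DL] D0] := (nu_gt0, al_gt0, al_small, D_large, D_gt0).
have DG := D_gt.
set e := _%:R.
have eE : \sum_(x in setT) (bip_edges G [set x] setT)%:R = e.
  by rewrite /e bip_edges_suml natr_sum.
have e0 : 0 <= e by apply: ler0n.
have sq : \sum_y (degs setT y) ^+ 2 <= e + nu ^+ 2 * ((1 + al) * D ^+ 2 / nu).
  by rewrite -eE; apply: (sq_degs setT).
have low : 0 <= \sum_y (degs setT y - D) ^+ 2.
  by apply: sumr_ge0 => y _; apply: sqr_ge0.
have e1 : \sum_y (degs setT y - D) ^+ 2 =
    \sum_y (degs setT y) ^+ 2 - 2 * D * e + nu * D ^+ 2.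
  rewrite -eE -sum_degs nuE mulr_sumr -sumrN mulr_suml -!big_split /=.
  by apply: eq_bigr => y _; ring.
have e2 : nu ^+ 2 * ((1 + al) * D ^+ 2 / nu) = (1 + al) * (D ^+ 2 * nu) by field; lra.
have D1 : 0 < 2 * D - 1 by nra.
rewrite -(ler_pM2r D1).
have : 0 <= D * nu * (al * D - 1 - al) by rewrite !mulr_ge0 //; lra.
by move: sq low; rewrite e1 e2; nra.
Qed.

(* Let x and y be the relative sizes of the complements of A and B. If
   1 - x - y >= 1/4, count the edges inside A x B through the total number of
   edges and the edges between the two complements; otherwise estimate the edges
   from A to the complement of B when y <= x, and those from the complement of A
   to B when x < y. So codegrees on one side suffice. *)
Lemma bip_cond_mixing (r : nat) : r%:R <= (1 - 24 * al) * D -> bip_cond r G.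
Proof.
have [[[[nu0 al0] al1] DL] D0] := (nu_gt0, al_gt0, al_small, D_large, D_gt0).
have DG := D_gt.
move=> rle; apply/bip_condP => A B.
rewrite -(ler_nat F) natrD !natrM natrD -/nu.
have cA : #|A|%:R = nu - #|~: A|%:R :> F by rewrite /nu cardsT -(cardsC A) natrD addrK.
have cB : #|B|%:R = nu - #|~: B|%:R :> F by rewrite /nu cardsT -(cardsC B) natrD addrK.
have a0 : 0 <= #|A|%:R :> F by apply: ler0n.
have b0 : 0 <= #|B|%:R :> F by apply: ler0n.
have s0 : 0 <= #|~: A|%:R :> F by apply: ler0n.
have t0 : 0 <= #|~: B|%:R :> F by apply: ler0n.
pose x : F := #|~: A|%:R / nu; pose y : F := #|~: B|%:R / nu.
have xE : #|~: A|%:R = nu * x by rewrite /x mulrC divfK // lt0r_neq0.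
have yE : #|~: B|%:R = nu * y by rewrite /y mulrC divfK // lt0r_neq0.
have x0 : 0 <= x by rewrite divr_ge0 // ltW.
have y0 : 0 <= y by rewrite divr_ge0 // ltW.
have x1 : x <= 1 by rewrite ler_pdivrMr // mul1r; lra.
have y1 : y <= 1 by rewrite ler_pdivrMr // mul1r; lra.
rewrite cA cB xE yE.
have eAnn : 0 <= (bip_edges G A B)%:R :> F by apply: ler0n.
have [neg|pos] := lerP (1 - x - y) 0.
  have : 0 <= r%:R * (nu * (x + y - 1)) by rewrite !mulr_ge0 //; lra.
  lra.
suff main : (1 - 24 * al) * (1 - x - y) * (D * nu) <= (bip_edges G A B)%:R.
  have : 0 <= ((1 - 24 * al) * D - r%:R) * (nu * (1 - x - y)).
    by rewrite !mulr_ge0 //; lra.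
  by move: main; lra.
set e := (bip_edges G A B)%:R in eAnn *.
have Dnu : 0 < D * nu by apply: mulr_gt0.
have degA : (1 - al) * (1 - x) * (D * nu) <= e + (bip_edges G A (~: B))%:R.
  rewrite -natrD -bip_edgesC bip_edges_suml natr_sum.
  have -> : (1 - al) * (1 - x) * (D * nu) = \sum_(z in A) (1 - al) * D.
    by rewrite sumr_const -mulr_natr cA xE; ring.
  by apply: ler_sum => z _; apply: deg_l.
have degTB : (1 - al) * (1 - y) * (D * nu) <= (bip_edges G setT B)%:R.
  rewrite bip_edges_sumr natr_sum.
  have -> : (1 - al) * (1 - y) * (D * nu) = \sum_(z in B) (1 - al) * D.
    by rewrite sumr_const -mulr_natr cB yE; ring.
  by apply: ler_sum => z _; apply: deg_r.
have degB : (1 - al) * (1 - y) * (D * nu) <= e + (bip_edges G (~: A) B)%:R.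
  apply: (le_trans degTB); rewrite -natrD ler_nat.
  rewrite /bip_edges -big_split; apply: leq_sum => p _ /=.
  by rewrite !inE; case: (_ \in A); rewrite /= ?addn0.
have aE : #|A|%:R / nu = 1 - x by rewrite cA xE; field; rewrite lt0r_neq0.
have bE : #|B|%:R / nu = 1 - y by rewrite cB yE; field; rewrite lt0r_neq0.
have u0 : 0 < 1 / D by rewrite divr_gt0.
have uD : 1 / D <= al / 200 by rewrite ler_pdivrMr // mulrAC ler_pdivlMr // mul1r.
have W0 := ltW Dnu; have Dn0 : D != 0 by rewrite lt0r_neq0.
have [big|small] := lerP (1 / 4) (1 - x - y).
  have tot : (bip_edges G A (~: B))%:R + (bip_edges G (~: A) (~: B))%:R
      <= (1 + al) * (D * nu) - (1 - al) * (1 - y) * (D * nu).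
    have -> : (bip_edges G A (~: B))%:R + (bip_edges G (~: A) (~: B))%:R
        = (bip_edges G setT setT)%:R - (bip_edges G setT B)%:R :> F.
      rewrite (bip_edgesC G setT B) natrD addrAC subrr add0r -natrD; congr _%:R.
      rewrite /bip_edges -big_split; apply: eq_bigr => p _ /=.
      by rewrite !inE; case: (_ \in A); rewrite /= ?addn0.
    by apply: lerB (degTB); apply: total_edges.
  apply: (mixing_arith_large al0 uD x0 y0 x1 W0 big degA tot).
  (* The discrepancy is used with [ga = x], which must be positive; for [x = 0] the bound to prove
     is nonpositive. *)
  have [x00|xn0] := eqVneq x 0.
    rewrite x00 !mul0r !mulr0 addr0 !add0r mulrN (le_trans _ (ler0n _ _)) //.
    by rewrite oppr_le0 mulr_ge0 // ltW.
  have xp : 0 < x by rewrite lt_neqAle eq_sym xn0.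
  have := bip_discrepancy (~: A) (~: B) xp; rewrite -/x -/y ler_norml => /andP[dis _].
  have <- : x * y / 2 + x / (x * D) + 3 * al * x ^+ 2 / (2 * x)
      = x * y / 2 + 1 / D + 3 / 2 * (al * x) by field; rewrite Dn0 xn0.
  by rewrite mulrBr addrC -lerBrDr.
have [yx|xy] := lerP y x.
  have x38 : 3 / 8 <= x by lra.
  have xp : 0 < x by apply: lt_le_trans x38; rewrite divr_gt0.
  have := bip_discrepancy A (~: B) xp; rewrite aE -/y ler_norml => /andP[_].
  have -> : (1 - x) / (x * D) = (1 - x) * (1 / D) / x.
    by field; rewrite Dn0 (lt0r_neq0 xp).
  exact: mixing_arith_left.
have y38 : 3 / 8 <= y by lra.
(* This [ga] makes the variance term [3 / 8 * x ^+ 2], free of [al]. *)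
have ga0 : 0 < 4 * al by rewrite mulr_gt0.
have := bip_discrepancy (~: A) B ga0; rewrite bE -/x ler_norml => /andP[_].
have -> : 4 * al * (1 - y) / 2 + x / (4 * al * D) + 3 * al * x ^+ 2 / (2 * (4 * al))
   = 2 * (al * (1 - y)) + x * (4 * (al * D))^-1 + 3 / 8 * x ^+ 2.
  by field; rewrite Dn0 (lt0r_neq0 al0).
apply: mixing_arith_right => //; last exact: ltW.
by rewrite div1r lef_pV2 ?posrE ?mulr_gt0 //; lra.
Qed.
End Mixing.

(** * Concentration on the symmetric group *)

Section PermConcentration.
Local Open Scope ring_scope.

Lemma exp_gt0 (x : R) : 0 < exp x.
Proof. by apply/RltP; exact: exp_pos. Qed.

Lemma exp_ge1Dx (x : R) : 1 + x <= exp x.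
Proof. by apply/RleP; exact: exp_ineq1_le. Qed.

Lemma expD (x y : R) : exp (x + y) = exp x * exp y.
Proof. by rewrite expRD. Qed.

Lemma ler_exp (x y : R) : x <= y -> exp x <= exp y.
Proof.
move=> xy; rewrite -(subrK x y) expD ler_peMl ?(ltW (exp_gt0 x)) //.
by apply: le_trans (exp_ge1Dx _); rewrite lerDl subr_ge0.
Qed.

(** From [exp d * (1 - d) <= 1], since [(1 + d + 2 * d ^+ 2) * (1 - d)] is
    [1 + d ^+ 2 * (1 - 2 * d)]. *)
Lemma exp_le_quad (d : R) : d <= 1 / 2 -> exp d <= 1 + d + 2 * d ^+ 2.
Proof.
move=> d2; have h : 0 < 1 - d by lra.
have : exp d * (1 - d) <= 1.
  apply: (@le_trans _ _ (exp d * exp (- d))).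
    by rewrite ler_pM2l ?exp_gt0 // exp_ge1Dx.
  by rewrite -expD subrr expR0.
rewrite -ler_pdivlMr // => /le_trans; apply; rewrite ler_pdivrMr //.
have : 0 <= d ^+ 2 * (1 / 2 - d) by rewrite mulr_ge0 ?sqr_ge0 // subr_ge0.
by rewrite !expr2; lra.
Qed.

(** Products act from left to right: if [s] fixes [a], then [s * tperm a b] sends [a] to [b]. So [b]
    runs over the possible images of [a]. *)
Lemma sum_perm_on_split (T : finType) (A : {set T}) a (F : {perm T} -> R) : a \in A ->
  \sum_(s | perm_on A s) F s =
  \sum_(b in A) \sum_(s | perm_on (A :\ a) s) F (s * tperm a b)%g.
Proof.
move=> aA; rewrite (partition_big (fun s : {perm T} => s a) (mem A)) /=; last first.
  by move=> s sA; rewrite perm_closed.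
apply: eq_bigr => b bA; rewrite (reindex_inj (mulIg (tperm a b))) /=.
have tA : perm_on A (tperm a b).
  apply/subsetP => x; rewrite inE; apply: contraNT => xA.
  by rewrite tpermD //; apply: contraNneq xA => <-.
apply: eq_bigl => s; rewrite permM.
have -> : (tperm a b (s a) == b) = (s a == a).
  by rewrite -{2}(tpermL a b) (inj_eq perm_inj).
have -> : perm_on A (s * tperm a b)%g = perm_on A s.
  apply/idP/idP => h; last exact: perm_onM.
  by rewrite -(mulgK (tperm a b) s) perm_onM // tpermV.
apply/andP/idP => [[/subsetP sA /eqP saa]|sA].
  apply/subsetP => x xs; rewrite !inE sA // andbT.
  by apply: contraTneq xs => ->; rewrite inE saa eqxx.
split; first by apply: subset_trans sA (subsetDl _ _).
by rewrite (out_perm sA) // !inE eqxx.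
Qed.

Lemma card_perm_on (T : finType) (A : {set T}) :
  \sum_(s : {perm T} | perm_on A s) (1 : R) = #|A|`!%:R.
Proof. by rewrite sumr_const -card_perm cardE. Qed.

(** A weak Hoeffding lemma: the linear terms of the quadratic bound for [exp] cancel. *)
Lemma mean_zero_exp_sum (I : finType) (A : {set I}) (d : I -> R) (c : R) :
  0 <= c -> c <= 1 / 2 -> (forall i, i \in A -> `|d i| <= c) ->
  \sum_(i in A) d i = 0 ->
  \sum_(i in A) exp (d i) <= #|A|%:R * exp (2 * c ^+ 2).
Proof.
move=> c0 c2 dc d0.
apply: (@le_trans _ _ (\sum_(i in A) (1 + d i + 2 * c ^+ 2))).
  apply: ler_sum => i iA; have := dc i iA; rewrite ler_norml => /andP[l u].
  apply: le_trans (exp_le_quad (le_trans u c2)) _.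
  by rewrite lerD2l ler_pM2l // -real_normK ?num_real // lerXn2r ?nnegrE ?dc.
rewrite !big_split /= d0 addr0 !sumr_const -mulrnDl -[_ *+ #|_|]mulr_natl.
by rewrite ler_wpM2l // exp_ge1Dx.
Qed.

(* Reveal the images of the points of A one by one: two possible images of the
   next point differ by a transposition, so the conditional means are within c. *)
Lemma perm_mgf (T : finType) (f : {perm T} -> R) (c : R) : 0 <= c -> c <= 1 / 4 ->
  forall (A : {set T}),
  (forall s x y, x \in A -> y \in A -> `|f (tperm x y * s)%g - f s| <= c) ->
  forall s0 m, \sum_(s | perm_on A s) f (s * s0)%g = #|A|`!%:R * m ->
  \sum_(s | perm_on A s) exp (f (s * s0)%g - m) <=
    #|A|`!%:R * exp (8 * c ^+ 2 * #|A|%:R).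
Proof.
move=> c0 c4 A; have [n] := ubnP #|A|; elim: n A => // n IH A.
rewrite ltnS => An lip s0 m mE.
have [A0|[a aA]] := set_0Vmem A.
  have only1 : (fun s : {perm T} => perm_on A s) =1 pred1 1%g.
    move=> s; rewrite A0; apply/idP/eqP => [h|->]; last exact: perm_on1.
    by apply/permP => x; rewrite perm1 (out_perm h) // inE.
  move: mE; rewrite !(eq_bigl _ _ only1) !big_pred1_eq A0 cards0 fact0 !mul1r => ->.
  by rewrite subrr mulr0.
set A' := A :\ a.
have cA : #|A| = #|A'|.+1 by rewrite (cardsD1 a) aA.
pose N : R := #|A'|`!%:R.
have N0 : 0 < N by rewrite ltr0n fact_gt0.
have cN : #|A|`!%:R = #|A|%:R * N by rewrite {1}cA factS -cA natrM.
pose mb b := (\sum_(s | perm_on A' s) f (s * (tperm a b * s0))%g) / N.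
have mbE b : \sum_(s | perm_on A' s) f (s * (tperm a b * s0))%g = N * mb b.
  by rewrite /mb mulrC divfK // lt0r_neq0.
have sumE (F : {perm T} -> R) : \sum_(s | perm_on A s) F (s * s0)%g =
    \sum_(b in A) \sum_(s | perm_on A' s) F (s * (tperm a b * s0))%g.
  rewrite (sum_perm_on_split (fun s => F (s * s0)%g) aA).
  by apply: eq_bigr => b _; apply: eq_bigr => s _; rewrite mulgA.
have A0 : 0 < #|A|%:R :> R by rewrite cA ltr0n.
have mean0 : \sum_(b in A) (mb b - m) = 0.
  apply/eqP; rewrite -(mulrI_eq0 _ (mulfI (lt0r_neq0 N0))) mulr_sumr.
  under eq_bigr do rewrite mulrBr -mbE.
  rewrite big_split /= -sumE mE cN sumr_const -mulr_natl; apply/eqP; ring.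
have diffa b : b \in A -> `|mb b - mb a| <= c.
  move=> bA; rewrite /mb -mulrBl normrM [`|N^-1|]gtr0_norm ?invr_gt0 //.
  rewrite ler_pdivrMr // -sumrB (le_trans (ler_norm_sum _ _ _)) //.
  have -> : c * N = \sum_(s : {perm T} | perm_on A' s) c.
    by rewrite /N -card_perm_on mulr_sumr mulr1.
  apply: ler_sum => s sA'; rewrite tperm1 mul1g.
  (* Conjugation moves the transposition to the front, where the Lipschitz hypothesis applies. *)
  have -> : (s * (tperm a b * s0) = tperm ((s^-1)%g a) ((s^-1)%g b) * (s * s0))%g.
    rewrite -tpermJ /conjg invgK !mulgA; congr (_ * _)%g.
    by rewrite -!mulgA mulVg mulg1.
  have sA : perm_on A (s^-1)%g.
    by apply: perm_onV; apply: subset_trans sA' (subsetDl _ _).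
  by apply: lip; rewrite perm_closed.
(* Conditional means within [c] of [mb a] are within [2 * c] of their average [m]. One step thus
   costs [2 * (2 * c) ^+ 2], the [8 * c ^+ 2] of the bound, and [c <= 1 / 4] makes [2 * c]
   admissible. *)
have diffm b : b \in A -> `|mb b - m| <= 2 * c.
  move=> bA; have -> : mb b - m = (mb b - mb a) + (mb a - m) by ring.
  rewrite (le_trans (ler_normD _ _)) // mulr_natl mulr2n lerD ?diffa //.
  rewrite -(ler_pM2l A0) -{1}(gtr0_norm A0) -normrM.
  have -> : #|A|%:R * (mb a - m) = \sum_(b' in A) (mb a - mb b').
    have -> : \sum_(b' in A) (mb a - mb b') = \sum_(b' in A) ((mb a - m) - (mb b' - m)).
      by apply: eq_bigr => b' _; ring.
    by rewrite big_split /= sumrN mean0 subr0 sumr_const mulr_natl.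
  rewrite (le_trans (ler_norm_sum _ _ _)) // mulr_natl -sumr_const.
  by apply: ler_sum => b' b'A; rewrite distrC diffa.
rewrite (sumE (fun s => exp (f s - m))).
apply: (@le_trans _ _ (\sum_(b in A) exp (mb b - m) * (N * exp (8 * c ^+ 2 * #|A'|%:R)))).
  apply: ler_sum => b bA.
  have -> : \sum_(s | perm_on A' s) exp (f (s * (tperm a b * s0))%g - m) =
      exp (mb b - m) * \sum_(s | perm_on A' s) exp (f (s * (tperm a b * s0))%g - mb b).
    rewrite mulr_sumr; apply: eq_bigr => s _; rewrite -expD; congr exp; ring.
  rewrite ler_wpM2l ?(ltW (exp_gt0 _)) //; apply: IH; rewrite ?mbE //.
    by rewrite -ltnS -cA.
  by move=> s x y; rewrite !inE => /andP[_ xA] /andP[_ yA]; apply: lip.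
rewrite -mulr_suml; apply: (@le_trans _ _
    (#|A|%:R * exp (2 * (2 * c) ^+ 2) * (N * exp (8 * c ^+ 2 * #|A'|%:R)))).
  rewrite ler_wpM2r ?mulr_ge0 ?(ltW N0) ?(ltW (exp_gt0 _)) //.
  by apply: mean_zero_exp_sum; rewrite ?mean0 //; lra.
rewrite cN mulrACA -expD ler_wpM2l ?mulr_ge0 ?(ltW A0) ?(ltW N0) //.
by apply: ler_exp; rewrite cA -natr1 le_eqVlt; apply/orP; left; apply/eqP; ring.
Qed.

(** Exponential Markov inequality for [la * f], whose Lipschitz constant is [2 * la]; the 32 is
    [8 * 2 ^ 2]. The base point [s0] prescribes the images outside [A], so the bound is conditional
    on them. *)
Lemma perm_tail (T : finType) (A : {set T}) (f : {perm T} -> R) (la x m : R) s0 :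
  0 <= la -> la <= 1 / 8 ->
  (forall s y z, y \in A -> z \in A -> `|f (tperm y z * s)%g - f s| <= 2) ->
  \sum_(s | perm_on A s) f (s * s0)%g = #|A|`!%:R * m ->
  \sum_(s | perm_on A s) (m + x <= f (s * s0)%g)%R%:R <=
    #|A|`!%:R * exp (32 * la ^+ 2 * #|A|%:R - la * x).
Proof.
move=> la0 la8 lip mE.
have lip' s y z : y \in A -> z \in A ->
    `|la * f (tperm y z * s)%g - la * f s| <= 2 * la.
  by move=> yA zA; rewrite -mulrBr normrM ger0_norm // mulrC ler_wpM2r // lip.
have c0 : 0 <= 2 * la by lra.
have c4 : 2 * la <= 1 / 4 by lra.
have := @perm_mgf T (fun s => la * f s) (2 * la) c0 c4 A lip' s0 (la * m).
rewrite -mulr_sumr mE mulrCA => /(_ erefl) mgf.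
rewrite expD mulrA -(ler_pM2r (exp_gt0 (la * x))) -[leRHS]mulrA -expD addNr expR0 mulr1.
have -> : 32 * la ^+ 2 * #|A|%:R = 8 * (2 * la) ^+ 2 * #|A|%:R :> R by ring.
apply: le_trans mgf; rewrite mulr_suml; apply: ler_sum => s _.
case: (boolP (m + x <= f (s * s0)%g)) => [h|_]; last by rewrite mul0r ltW ?exp_gt0.
by rewrite mul1r ler_exp // -mulrBr ler_wpM2l //; lra.
Qed.

(** Averaging over [s0]: each permutation is reached as [s * s0] once for every [s] supported in
    [A]. So a bound conditional on the images outside [A] becomes unconditional. *)
Lemma perm_cond_count (T : finType) (A : {set T}) (bad : {perm T} -> bool) (de : R) :
  (forall s0, \sum_(s | perm_on A s) (bad (s * s0)%g)%:R <= #|A|`!%:R * de) ->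
  \sum_(s : {perm T}) (bad s)%:R <= #|[set: {perm T}]|%:R * de.
Proof.
move=> h; have A0 : 0 < #|A|`!%:R :> R by rewrite ltr0n fact_gt0.
rewrite -(ler_pM2l A0) -{1}card_perm_on mulr_suml.
apply: (@le_trans _ _ (\sum_(s0 : {perm T}) \sum_(s | perm_on A s) (bad (s * s0)%g)%:R)).
  rewrite exchange_big /=; apply: ler_sum => s _; rewrite mul1r.
  by rewrite [leLHS](reindex_inj (mulgI s)).
have -> : #|A|`!%:R * (#|[set: {perm T}]|%:R * de) = \sum_(s0 : {perm T}) #|A|`!%:R * de.
  by rewrite cardsT mulrCA sumr_const [LHS]mulr_natl.
by apply: ler_sum => s0 _; apply: h.
Qed.

(* Composing with a transposition of A shows that the number of permutations
   mapping J to Y does not change when one element of Y is exchanged. *)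
Lemma perm_on_imset_count (T : finType) (A J Y : {set T}) :
  J \subset A -> Y \subset A -> #|Y| = #|J| ->
  (#|[set s : {perm T} | perm_on A s && (s @: J == Y)]| * 'C(#|A|, #|J|) = #|A|`!)%N.
Proof.
move=> JA; pose h (Y : {set T}) := #|[set s : {perm T} | perm_on A s && (s @: J == Y)]|.
have h_tperm (Z : {set T}) y z : y \in A -> z \in A -> h (tperm y z @: Z) = h Z.
  move=> yA zA; rewrite /h -[RHS](card_imset _ (mulIg (tperm y z))); apply: eq_card => s.
  have tA : perm_on A (tperm y z).
    apply/subsetP => x; rewrite inE; apply: contraNT => xA.
    by rewrite tpermD //; apply: contraNneq xA => <-.
  rewrite inE; apply/andP/imsetP => [[sA /eqP sJ]|[s' ]].
    exists (s * tperm y z)%g; last by rewrite -mulgA tperm2 mulg1.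
    rewrite inE perm_onM //=; apply/eqP.
    have -> : (s * tperm y z)%g @: J = tperm y z @: (s @: J).
      by rewrite -imset_comp; apply: eq_imset => x; rewrite permM.
    by rewrite sJ -imset_comp -[RHS]imset_id; apply: eq_imset => x /=; rewrite tpermK.
  rewrite inE => /andP[s'A /eqP s'J] ->; split; first exact: perm_onM.
  apply/eqP; rewrite -s'J -imset_comp; apply: eq_imset => x; exact: permM.
have h_const (Z Z' : {set T}) : Z \subset A -> Z' \subset A -> #|Z| = #|Z'| -> h Z = h Z'.
  have [n] := ubnP #|Z :\: Z'|; elim: n Z => // n IH Z; rewrite ltnS => Zn ZA Z'A cZ.
  have [/eqP|[y]] := set_0Vmem (Z :\: Z').
    rewrite setD_eq0 => ZZ'; congr h; apply/eqP.
    by rewrite eqEcard ZZ' cZ leqnn.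
  rewrite inE => /andP[yZ' yZ].
  have [z zZ' zZ] : exists2 z, z \in Z' & z \notin Z.
    apply/subsetPn; apply: contra yZ' => Z'Z.
    by have /eqP -> : Z' == Z by rewrite eqEcard Z'Z cZ leqnn.
  have yA : y \in A by apply: (subsetP ZA).
  have zA : z \in A by apply: (subsetP Z'A).
  have eW : tperm y z @: Z = z |: (Z :\ y).
    apply/setP => x; apply/imsetP/idP => [[w wZ ->]|].
      rewrite !inE; case: tpermP => [_|wz|/eqP wy /eqP wz]; rewrite ?eqxx //.
        by rewrite -wz wZ in zZ.
      by rewrite wy wZ orbT.
    rewrite !inE => /orP[/eqP ->|/andP[xy xZ]]; first by exists y; rewrite ?tpermL.
    by exists x => //; rewrite tpermD // eq_sym //; apply: contraNneq zZ => <-.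
  rewrite -(h_tperm Z y z yA zA); apply: IH.
  - apply: leq_trans Zn; apply: proper_card; apply/properP; split.
      apply/subsetP => x; rewrite eW !inE => /andP[xZ' /orP[/eqP xz|/andP[_ ->]]].
        by rewrite xz zZ' in xZ'.
      by rewrite xZ'.
    exists y; first by rewrite inE yZ' yZ.
    rewrite eW !inE eqxx /= orbF negb_and negbK.
    by apply/orP; right; apply: contraNneq yZ' => ->.
  - by rewrite eW subUset sub1set zA (subset_trans (subsetDl _ _)).
  - exact: Z'A.
  - by rewrite card_imset //; apply: perm_inj.
move=> YA cY; rewrite -/(h Y).
have -> : #|A|`! = (\sum_(Z : {set T} | (Z \subset A) && (#|Z| == #|J|)) h Z)%N.
  transitivity (\sum_(s : {perm T} | perm_on A s) 1)%N.
    by rewrite sum1_card -card_perm.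
  rewrite (partition_big (fun s : {perm T} => s @: J)
     (fun Z : {set T} => (Z \subset A) && (#|Z| == #|J|))) /=.
    apply: eq_bigr => Z _; rewrite /h -sum1_card; apply: eq_bigl => s.
    by rewrite !inE.
  move=> s sA; rewrite card_imset ?eqxx ?andbT; last exact: perm_inj.
  apply/subsetP => x /imsetP[y yJ ->]; rewrite perm_closed //; exact: (subsetP JA).
rewrite (eq_bigr (fun=> h Y)); last first.
  by move=> Z /andP[ZA /eqP cZ]; apply: h_const; rewrite // cZ cY.
rewrite sum_nat_const mulnC -cards_draws; congr (_ * _)%N.
by apply: eq_card => Z; rewrite !inE.
Qed.

Lemma sum_perm_on_imset (T : finType) (A J : {set T}) (F : {set T} -> R) :
  J \subset A ->
  \sum_(s : {perm T} | perm_on A s) F (s @: J) =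
  #|A|`!%:R / 'C(#|A|, #|J|)%:R * \sum_(Y : {set T} | (Y \subset A) && (#|Y| == #|J|)) F Y.
Proof.
move=> JA; rewrite (partition_big (fun s : {perm T} => s @: J)
     (fun Z : {set T} => (Z \subset A) && (#|Z| == #|J|))) /=; last first.
  move=> s sA; rewrite card_imset ?eqxx ?andbT; last exact: perm_inj.
  apply/subsetP => x /imsetP[y yJ ->]; rewrite perm_closed //; exact: (subsetP JA).
rewrite mulr_sumr; apply: eq_bigr => Y /andP[YA /eqP cY].
rewrite (eq_bigr (fun=> F Y)); last by move=> s /andP[_ /eqP ->].
have C0 : 'C(#|A|, #|J|)%:R != 0 :> R.
  by rewrite pnatr_eq0 -lt0n bin_gt0 subset_leq_card.
rewrite -(perm_on_imset_count JA YA cY) natrM mulfK // sumr_const mulr_natl.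
by congr (_ *+ _); apply: eq_card => s; rewrite !inE.
Qed.
End PermConcentration.

(** The blocks are fixed; the random blocks are their images [s @: I i] and [s @: J j] under one
    random permutation. *)
Definition block_system (T V : finType) (a b : nat) (I J : V -> {set T}) : Prop :=
  [/\ forall i, #|I i| = a, forall j, #|J j| = b,
      forall i i', i != i' -> [disjoint I i & I i'],
      forall j j', j != j' -> [disjoint J j & J j'] &
      forall i j, [disjoint I i & J j]].

(** * Counting the blocks whose random image has a given property *)

Section BlockCounts.
Local Open Scope ring_scope.
Variables (T V : finType) (J : V -> {set T}) (A : {set T}) (b : nat).
Variable P : {perm T} -> pred {set T}.
Hypothesis cardJ : forall j, #|J j| = b.
Hypothesis disjJ : forall j j', j != j' -> [disjoint J j & J j'].
Hypothesis subJ : forall j, J j \subset A.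
Hypothesis leqbA : (b <= #|A|)%N.
Hypothesis P_prefix : forall s s0, perm_on A s -> P (s * s0)%g =1 P s0.

Let f (s : {perm T}) : R := \sum_j (P s (s @: J j))%:R.

Definition block_choices (s0 : {perm T}) : nat :=
  #|[set Y : {set T} | [&& Y \subset s0 @: A, #|Y| == b & P s0 Y]]|.

(** The predicate frozen at [s0]. As [P s] depends only on the images outside [A], this agrees with
    [f] on the products [s * s0] with [s] supported in [A]. *)
Let g (s0 s : {perm T}) : R := \sum_j (P s0 (s @: J j))%:R.

(** Exchanging the images of [y] and [z] affects only the blocks containing them, at most one each
    by disjointness. *)
Let g_lip s0 s y z : y \in A -> z \in A -> `|g s0 (tperm y z * s)%g - g s0 s| <= 2.
Proof.
move=> _ _; rewrite /g -sumrB (le_trans (ler_norm_sum _ _ _)) //.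
have once x : \sum_j (x \in J j)%:R <= 1 :> R.
  have [[j xj]|no] := altP (@existsP _ (fun j => x \in J j)).
    rewrite (bigD1 j) //= xj big1 ?addr0 // => j' j'j.
    by rewrite (disjointFr _ xj) // disjJ // eq_sym.
  rewrite big1 // => j _; rewrite negb_exists in no.
  by rewrite (negbTE (forallP no j)).
apply: (@le_trans _ _ (\sum_j ((y \in J j)%:R + (z \in J j)%:R))).
  apply: ler_sum => j _; have [yz|] := boolP ((y \in J j) || (z \in J j)).
    apply: (@le_trans _ _ 1); last first.
      by rewrite -natrD ler1n; move: yz; do 2 case: (_ \in J j).
    by case: (P _ _); case: (P _ _); rewrite ?subrr ?subr0 ?sub0r ?normrN ?normr1 ?normr0.
  rewrite negb_or => /andP[yJ zJ].
  have -> : (tperm y z * s)%g @: J j = s @: J j.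
    apply: eq_in_imset => x xJ; rewrite permM tpermD //.
      by apply: contraNneq yJ => ->.
    by apply: contraNneq zJ => ->.
  by rewrite subrr normr0 addr_ge0.
by rewrite big_split /= (natrD _ 1 1) lerD.
Qed.

Let fg s0 s : perm_on A s -> f (s * s0)%g = g s0 (s * s0)%g.
Proof. by move=> sA; apply: eq_bigr => j _; rewrite P_prefix. Qed.

Let g_mean s0 : \sum_(s | perm_on A s) g s0 (s * s0)%g =
  #|A|`!%:R * (#|V|%:R * (block_choices s0)%:R / 'C(#|A|, b)%:R).
Proof.
rewrite /g exchange_big /=.
have one j : \sum_(s | perm_on A s) (P s0 ((s * s0)%g @: J j))%:R =
    #|A|`!%:R / 'C(#|A|, b)%:R * (block_choices s0)%:R :> R.
  transitivity (\sum_(s | perm_on A s) (P s0 (s0 @: (s @: J j)))%:R : R).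
    apply: eq_bigr => s _; congr (P s0 _)%:R.
    by rewrite -imset_comp; apply: eq_imset => x; rewrite permM.
  rewrite (sum_perm_on_imset (fun Y => (P s0 (s0 @: Y))%:R : R) (subJ j)) cardJ.
  congr (_ * _); rewrite /block_choices.
  have imK : cancel (fun Y : {set T} => s0 @: Y) (fun Y : {set T} => (s0^-1)%g @: Y).
    move=> Y /=; rewrite -imset_comp -[RHS]imset_id.
    by apply: eq_imset => x /=; rewrite permK.
  rewrite -(card_in_imset (f := fun Y : {set T} => (s0^-1)%g @: Y)); last first.
    by move=> Y Z _ _ /imset_inj; apply; apply: perm_inj.
  rewrite -sum1_card natr_sum [RHS]big_mkcond [LHS]big_mkcond /=.
  apply: eq_bigr => Y _.
  suff -> : (Y \in [set (s0^-1)%g @: (Z : {set T}) | Z in [set Z : {set T} |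
      [&& Z \subset s0 @: A, #|Z| == b & P s0 Z]]]) = (Y \subset A) && (#|Y| == b) && P s0 (s0 @: Y).
    by case: (Y \subset A); case: (#|Y| == b); case: (P _ _).
  rewrite -andbA; apply/imsetP/idP; last first.
    move=> /and3P[YA cY PY]; exists (s0 @: Y); last by rewrite imK.
    by rewrite inE imsetS // card_imset ?cY //; apply: perm_inj.
  move=> [Z]; rewrite inE => /and3P[ZA cZ PZ] ->.
  have ZE : s0 @: ((s0^-1)%g @: Z) = Z.
    by rewrite -imset_comp -[RHS]imset_id; apply: eq_imset => x /=; rewrite permKV.
  rewrite ZE PZ andbT card_imset ?cZ; last exact: perm_inj.
  rewrite andbT; apply/subsetP => x /imsetP[z zZ ->].
  by have /imsetP[w wA ->] := subsetP ZA z zZ; rewrite permK.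
rewrite (eq_bigr _ (fun j _ => one j)) sumr_const -[_ *+ #|_|]mulr_natl.
by ring.
Qed.

(** [m] must bound the conditional mean for every [s0]: given the images outside [A], each block
    lands on a uniform [b]-subset of [s0 @: A]. *)
Lemma block_upper_tail (la x m : R) :
  0 <= la -> la <= 1 / 8 ->
  (forall s0, #|V|%:R * (block_choices s0)%:R <= m * 'C(#|A|, b)%:R) ->
  \sum_(s : {perm T}) (m + x <= \sum_j (P s (s @: J j))%:R)%R%:R <=
    #|[set: {perm T}]|%:R * exp (32 * la ^+ 2 * #|A|%:R - la * x).
Proof.
move=> la0 la8 hm.
apply: (@perm_cond_count T A (fun s => m + x <= f s)) => s0.
apply: le_trans (perm_tail x la0 la8 (@g_lip s0) (g_mean s0)).
apply: ler_sum => s sA; rewrite ler_nat -/(f _) fg //.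
case: (boolP (m + x <= _)) => // h; rewrite lt0b; apply: le_trans h.
rewrite lerD2r.
by rewrite ler_pdivrMr ?ltr0n ?bin_gt0.
Qed.

Lemma block_lower_tail (la x m : R) :
  0 <= la -> la <= 1 / 8 ->
  (forall s0, m * 'C(#|A|, b)%:R <= #|V|%:R * (block_choices s0)%:R) ->
  \sum_(s : {perm T}) (\sum_j (P s (s @: J j))%:R <= m - x)%R%:R <=
    #|[set: {perm T}]|%:R * exp (32 * la ^+ 2 * #|A|%:R - la * x).
Proof.
move=> la0 la8 hm.
apply: (@perm_cond_count T A (fun s => f s <= m - x)) => s0.
have lipN s y z : y \in A -> z \in A ->
    `|- g s0 (tperm y z * s)%g - (- g s0 s)| <= 2.
  by move=> yA zA; rewrite opprK addrC distrC g_lip.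
have meanN : \sum_(s | perm_on A s) - g s0 (s * s0)%g =
  #|A|`!%:R * - (#|V|%:R * (block_choices s0)%:R / 'C(#|A|, b)%:R).
  by rewrite sumrN g_mean mulrN.
apply: le_trans (perm_tail x la0 la8 lipN meanN).
apply: ler_sum => s sA; rewrite ler_nat -/(f _) fg //.
case: (boolP (_ <= m - x)) => // h; rewrite lt0b.
have hm' : m <= #|V|%:R * (block_choices s0)%:R / 'C(#|A|, b)%:R.
  by rewrite ler_pdivlMr ?ltr0n ?bin_gt0.
by lra.
Qed.
End BlockCounts.

(** * The bipartite graph of a random permutation *)

Definition bip_of (T V : finType) (E : {set {set T}}) (I J : V -> {set T})
    (s : {perm T}) : {set V * V} :=
  [set p | s @: (I p.1 :|: J p.2) \in E].

Definition well_spread (V : finType) (G : {set V * V}) (lo hi : R) : bool :=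
  [&& [forall x, (lo <= (bip_edges G [set x] setT)%:R)%R],
      [forall y, (lo <= (bip_edges G setT [set y])%:R)%R] &
      [forall x, forall x', (x != x') ==> ((bip_codeg G x x')%:R <= hi)%R]].

(** A union bound over an arbitrary sample space, because it serves twice: for random permutations
    and for random colourings. *)
Lemma well_spread_union (Om V : finType) (G : Om -> {set V * V}) (lo hi t : R) :
  (0 <= t)%R ->
  (forall i, \sum_w ((bip_edges (G w) [set i] setT)%:R <= lo)%R%:R <= t)%R ->
  (forall j, \sum_w ((bip_edges (G w) setT [set j])%:R <= lo)%R%:R <= t)%R ->
  (forall i i', i != i' -> \sum_w (hi <= (bip_codeg (G w) i i')%:R)%R%:R <= t)%R ->
  (\sum_w (~~ well_spread (G w) lo hi)%:R <= (2 * #|V|%:R + #|V|%:R ^+ 2) * t)%R.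
Proof.
move=> t0 hl hr hc; set nu : R := (#|V|%:R)%R.
have nuE : (nu = \sum_(i : V) 1)%R by rewrite sumr_const.
pose bl i w : R := ((bip_edges (G w) [set i] setT)%:R <= lo)%R%:R%R.
pose br j w : R := ((bip_edges (G w) setT [set j])%:R <= lo)%R%:R%R.
pose bc i i' w : R := ((i != i')%:R * (hi <= (bip_codeg (G w) i i')%:R)%R%:R)%R.
have bl0 i w : (0 <= bl i w)%R by apply: ler0n.
have br0 i w : (0 <= br i w)%R by apply: ler0n.
have bc0 i i' w : (0 <= bc i i' w)%R by rewrite mulr_ge0 ?ler0n.
have one (W : finType) (h : W -> R) w :
    (forall w, 0 <= h w)%R -> h w = 1%R -> (1 <= \sum_w h w)%R.
  by move=> h0 hw; rewrite (bigD1 w) //= hw lerDl sumr_ge0.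
apply: (@le_trans _ _ (\sum_w (\sum_i bl i w + \sum_j br j w
    + \sum_i \sum_i' bc i i' w))%R).
  apply: ler_sum => w _.
  have S1 : (0 <= \sum_i bl i w)%R by apply: sumr_ge0.
  have S2 : (0 <= \sum_i br i w)%R by apply: sumr_ge0.
  have S3' i : (0 <= \sum_i' bc i i' w)%R by apply: sumr_ge0.
  have S3 : (0 <= \sum_i \sum_i' bc i i' w)%R by apply: sumr_ge0.
  case: (boolP (well_spread _ _ _)) => [_|]; first by rewrite !addr_ge0.
  rewrite /well_spread !negb_and => bad; apply: (@le_trans _ _ 1%R); first by [].
  case/or3P: bad => /forallPn[i].
  - rewrite -ltNge => /ltW h; have h1 : (1 <= \sum_i bl i w)%R by apply: (one _ _ i) => //; rewrite /bl h.
    by lra.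
  - rewrite -ltNge => /ltW h; have h1 : (1 <= \sum_i br i w)%R by apply: (one _ _ i) => //; rewrite /br h.
    by lra.
  move=> /forallPn[i']; rewrite negb_imply -ltNge => /andP[ii' /ltW h].
  have h1 : (1 <= \sum_i' bc i i' w)%R by apply: (one _ _ i') => //; rewrite /bc ii' h mulr1.
  have : (\sum_i' bc i i' w <= \sum_i \sum_i' bc i i' w)%R.
    by rewrite [leRHS](bigD1 i) //= lerDl sumr_ge0.
  by lra.
rewrite !big_split /= mulrDl lerD //.
  rewrite -(_ : nu + nu = 2 * nu)%R; last by ring.
  rewrite mulrDl lerD // exchange_big nuE mulr_suml /= ler_sum // => i _.
    by rewrite mul1r hl.
  by rewrite mul1r hr.
rewrite exchange_big nuE expr2 mulr_suml mulr_suml; apply: ler_sum => i _.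
rewrite mul1r mulr_suml exchange_big /=; apply: ler_sum => i' _; rewrite mul1r.
rewrite -mulr_sumr; case: (eqVneq i i') => [_|ii']; first by rewrite mul0r.
by rewrite mul1r hc.
Qed.

Lemma perm_on_prefix (T : finType) (B : {set T}) (s s0 : {perm T}) :
  perm_on (~: B) s -> (s * s0)%g @: B = s0 @: B.
Proof.
move=> sB; apply: eq_in_imset => x xB.
by rewrite permM (out_perm sB) // inE xB.
Qed.

(** Disjointness is not written into [nbhd]; the size of the union forces it. *)
Lemma nbhd_disjoint (n k : nat) (E : {set {set 'I_n}}) (S Y : {set 'I_n}) :
  uniform k E -> #|S| <= k -> Y \in nbhd k E S -> [disjoint S & Y].
Proof.
move=> uE Sk; rewrite inE => /andP[/eqP cY /uE cSY].
rewrite -setI_eq0 -cards_eq0; have := cardsUI S Y; lia.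
Qed.

Section GoodPerms.
Local Open Scope ring_scope.
Variables (n a b : nat) (V : finType) (E : {set {set 'I_n}}).
Variables (I J : V -> {set 'I_n}) (p e la x : R).
Hypothesis uE : uniform (a + b) E.
Hypothesis sys : block_system a b I J.
Hypothesis abn : (a + b <= n)%N.
Hypothesis deg_a : forall S : {set 'I_n}, #|S| = a ->
  (1 - e) * 'C(n - a, b)%:R * p <= (deg (a + b) E S)%:R.
Hypothesis deg_b : forall S : {set 'I_n}, #|S| = b ->
  (1 - e) * 'C(n - b, a)%:R * p <= (deg (a + b) E S)%:R.
Hypothesis codeg_a : forall S1 S2 : {set 'I_n}, #|S1| = a -> #|S2| = a ->
  [disjoint S1 & S2] ->
  (#|nbhd (a + b) E S1 :&: nbhd (a + b) E S2|)%:R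
    <= (1 + e) * 'C(n - 2 * a, b)%:R * p ^+ 2.
Hypothesis la0 : 0 <= la.
Hypothesis la8 : la <= 1 / 8.

Let nu : R := #|V|%:R.
Let tail : R := #|[set: {perm 'I_n}]|%:R * exp (32 * la ^+ 2 * n%:R - la * x).

Let tail_le (A : {set 'I_n}) :
  #|[set: {perm 'I_n}]|%:R * exp (32 * la ^+ 2 * #|A|%:R - la * x) <= tail.
Proof.
rewrite ler_wpM2l // ler_exp // lerD2r ler_wpM2l ?mulr_ge0 ?sqr_ge0 //.
by rewrite ler_nat -[leqRHS]card_ord max_card.
Qed.

(** Reveal [s] on [I i] alone. The admissible [b]-sets are then the neighbours of the [a]-set
    [s @: I i] among all ['C(n - a, b)] candidates, so the degree condition bounds the conditional
    mean. *)
Lemma bip_degl_tail i :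
  \sum_(s : {perm 'I_n})
    ((bip_edges (bip_of E I J s) [set i] setT)%:R <= (1 - e) * p * nu - x)%R%:R <= tail.
Proof.
have [cI cJ dI dJ dIJ] := sys.
pose P (s : {perm 'I_n}) (Y : {set 'I_n}) := s @: I i :|: Y \in E.
have cA : #|~: I i| = (n - a)%N by rewrite cardsCs setCK cI card_ord.
have subJ j : J j \subset ~: I i by rewrite -disjoints_subset disjoint_sym.
have pre s s0 : perm_on (~: I i) s -> P (s * s0)%g =1 P s0.
  by move=> sA Y; rewrite /P perm_on_prefix.
have leb : (b <= #|~: I i|)%N by rewrite cA; lia.
apply: le_trans (tail_le (~: I i)).
apply: le_trans (block_lower_tail cJ dJ subJ leb pre x (m := (1 - e) * p * nu) la0 la8 _).
  apply: ler_sum => s _; rewrite ler_nat.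
  have -> : (bip_edges (bip_of E I J s) [set i] setT)%:R = \sum_j (P s (s @: J j))%:R :> R.
    rewrite bip_edgesE; apply: eq_big => [j|j _]; rewrite ?inE // big_set1.
    by rewrite inE /= imsetU.
  by [].
move=> s0; rewrite cA.
have cS : #|s0 @: I i| = a by rewrite card_imset ?cI //; apply: perm_inj.
apply: (@le_trans _ _ (nu * (deg (a + b) E (s0 @: I i))%:R)).
  have -> : (1 - e) * p * nu * 'C(n - a, b)%:R = nu * ((1 - e) * 'C(n - a, b)%:R * p) by ring.
  by rewrite ler_wpM2l ?ler0n // deg_a.
rewrite ler_wpM2l ?ler0n // ler_nat; apply: subset_leq_card; apply/subsetP => Y YN.
rewrite inE; have dis := nbhd_disjoint uE _ YN.
move: YN; rewrite inE cS addKn => /andP[cY YE]; apply/and3P; split => //.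
apply/subsetP => y yY.
rewrite -[y](permKV s0); apply: imset_f; rewrite inE.
apply/negP => yI; have := dis; rewrite cS leq_addr => /(_ isT) /disjointFl /(_ yY).
by rewrite -{1}[y](permKV s0) imset_f.
Qed.

Lemma bip_degr_tail j :
  \sum_(s : {perm 'I_n})
    ((bip_edges (bip_of E I J s) setT [set j])%:R <= (1 - e) * p * nu - x)%R%:R <= tail.
Proof.
have [cI cJ dI dJ dIJ] := sys.
pose P (s : {perm 'I_n}) (Y : {set 'I_n}) := s @: J j :|: Y \in E.
have cA : #|~: J j| = (n - b)%N by rewrite cardsCs setCK cJ card_ord.
have subI i : I i \subset ~: J j by rewrite -disjoints_subset.
have pre s s0 : perm_on (~: J j) s -> P (s * s0)%g =1 P s0.
  by move=> sA Y; rewrite /P perm_on_prefix.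
have leb : (a <= #|~: J j|)%N by rewrite cA; lia.
apply: le_trans (tail_le (~: J j)).
apply: le_trans (block_lower_tail cI dI subI leb pre x (m := (1 - e) * p * nu) la0 la8 _).
  apply: ler_sum => s _; rewrite ler_nat.
  have -> : (bip_edges (bip_of E I J s) setT [set j])%:R = \sum_i (P s (s @: I i))%:R :> R.
    rewrite bip_edgesE big_set1; apply: eq_big => [i|i _]; rewrite ?inE //.
    by rewrite /= imsetU setUC.
  by [].
move=> s0; rewrite cA.
have cS : #|s0 @: J j| = b by rewrite card_imset ?cJ //; apply: perm_inj.
apply: (@le_trans _ _ (nu * (deg (a + b) E (s0 @: J j))%:R)).
  have -> : (1 - e) * p * nu * 'C(n - b, a)%:R = nu * ((1 - e) * 'C(n - b, a)%:R * p) by ring.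
  by rewrite ler_wpM2l ?ler0n // deg_b.
rewrite ler_wpM2l ?ler0n // ler_nat; apply: subset_leq_card; apply/subsetP => Y YN.
rewrite inE; have dis := nbhd_disjoint uE _ YN.
move: YN; rewrite inE cS addnK => /andP[cY YE]; apply/and3P; split => //.
apply/subsetP => y yY.
rewrite -[y](permKV s0); apply: imset_f; rewrite inE.
apply/negP => yI; have := dis; rewrite cS leq_addl => /(_ isT) /disjointFl /(_ yY).
by rewrite -{1}[y](permKV s0) imset_f.
Qed.

(** Two disjoint blocks are revealed, leaving [n - 2 * a] points: the binomial of the codegree
    condition. *)
Lemma bip_codeg_tail i i' : i != i' ->
  \sum_(s : {perm 'I_n})
    ((1 + e) * p ^+ 2 * nu + x <= (bip_codeg (bip_of E I J s) i i')%:R)%R%:R <= tail.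
Proof.
move=> ii'; have [cI cJ dI dJ dIJ] := sys.
pose P (s : {perm 'I_n}) (Y : {set 'I_n}) :=
  (s @: I i :|: Y \in E) && (s @: I i' :|: Y \in E).
have cU : #|I i :|: I i'| = (2 * a)%N.
  by rewrite cardsU (eqP (_ : I i :&: I i' == set0)) ?setI_eq0 ?dI // cards0 !cI; lia.
have cA : #|~: (I i :|: I i')| = (n - 2 * a)%N by rewrite cardsCs setCK cU card_ord.
have subJ j : J j \subset ~: (I i :|: I i').
  by rewrite -disjoints_subset disjoint_sym disjoints_subset subUset -!disjoints_subset !dIJ.
have pre s s0 : perm_on (~: (I i :|: I i')) s -> P (s * s0)%g =1 P s0.
  move=> sA Y; have := perm_on_prefix s0 sA; rewrite !imsetU => e0.
  have sub (B : {set 'I_n}) : B \subset I i :|: I i' -> perm_on (~: B) s.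
    by move=> BS; apply: subset_trans sA _; rewrite setCS.
  by rewrite /P !perm_on_prefix // sub ?subsetUl ?subsetUr.
have leb : (b <= #|~: (I i :|: I i')|)%N by rewrite -(cJ i) subset_leq_card.
apply: le_trans (tail_le (~: (I i :|: I i'))).
apply: le_trans (block_upper_tail cJ dJ subJ leb pre x (m := (1 + e) * p ^+ 2 * nu) la0 la8 _).
  apply: ler_sum => s _; rewrite ler_nat.
  have -> : (bip_codeg (bip_of E I J s) i i')%:R = \sum_j (P s (s @: J j))%:R :> R.
    rewrite /bip_codeg cardsE -sum1_card natr_sum big_mkcond /=.
    apply: eq_bigr => j _; rewrite unfold_in !inE /= !imsetU /P.
    by case: (_ && _).
  by [].
move=> s0; rewrite cA.
have cS : #|s0 @: I i| = a by rewrite card_imset ?cI //; apply: perm_inj.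
have cS' : #|s0 @: I i'| = a by rewrite card_imset ?cI //; apply: perm_inj.
have dS : [disjoint s0 @: I i & s0 @: I i'].
  rewrite -setI_eq0 -imsetI; last by move=> y z _ _; apply: perm_inj.
  by rewrite (eqP (_ : I i :&: I i' == set0)) ?setI_eq0 ?dI // imset0.
apply: (@le_trans _ _ (nu * (#|nbhd (a + b) E (s0 @: I i) :&: nbhd (a + b) E (s0 @: I i')|)%:R)).
  rewrite ler_wpM2l ?ler0n // ler_nat; apply: subset_leq_card; apply/subsetP => Y.
  by rewrite !inE cS cS' addKn => /and3P[_ -> /andP[-> ->]].
have -> : (1 + e) * p ^+ 2 * nu * 'C(n - 2 * a, b)%:R = nu * ((1 + e) * 'C(n - 2 * a, b)%:R * p ^+ 2) by ring.
by rewrite ler_wpM2l ?ler0n // codeg_a.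
Qed.

Lemma few_bad_perms :
  \sum_(s : {perm 'I_n}) (~~ well_spread (bip_of E I J s)
     ((1 - e) * p * nu - x) ((1 + e) * p ^+ 2 * nu + x))%:R <= (2 * nu + nu ^+ 2) * tail.
Proof.
apply: well_spread_union bip_degl_tail bip_degr_tail bip_codeg_tail.
by rewrite mulr_ge0 ?ler0n // ltW ?exp_gt0.
Qed.
End GoodPerms.

(** * Greedy selection and random colourings *)

Section Selection.
Local Open Scope ring_scope.

(* Multiplicative weights: each new w is chosen so that the current weight
   (1 + et) ^ (number of earlier appearances) of the elements it contains is at
   most the average. *)
Lemma greedy_selection (Om X : finType) (Gd : {set Om}) (E : {set X})
    (inc : Om -> X -> bool) (q et : R) :
  0 <= et -> 0 <= q -> (0 < #|Gd|)%N ->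
  (forall e, e \in E -> \sum_(w in Gd) (inc w e)%:R <= q * #|Gd|%:R) ->
  forall N, exists2 om : nat -> Om, (forall r, om r \in Gd) &
    \sum_(e in E) (1 + et) ^+ (\sum_(r < N) inc (om r) e)
      <= #|E|%:R * (1 + et * q) ^+ N.
Proof.
move=> et0 q0 /card_gt0P[w0 w0G] freq; elim=> [|N [om omG IH]].
  exists (fun=> w0) => //; rewrite expr0 mulr1 -sum1_card natr_sum.
  by apply: ler_sum => e _; rewrite big_ord0 expr0.
pose W e : R := (1 + et) ^+ (\sum_(r < N) inc (om r) e).
have W0 e : 0 <= W e by rewrite exprn_ge0 // addr_ge0.
have [w wG hw] : exists2 w, w \in Gd &
    \sum_(e in E) W e * (inc w e)%:R <= q * \sum_(e in E) W e.
  apply/exists_inP; apply: contraT; rewrite negb_exists_in => /forall_inP no.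
  have G0 : 0 < #|Gd|%:R :> R by rewrite ltr0n; apply/card_gt0P; exists w0.
  have : \sum_(w in Gd) q * (\sum_(e in E) W e) < \sum_(w in Gd) \sum_(e in E) W e * (inc w e)%:R.
    apply: ltr_sum; last by move=> w wG; rewrite ltNge no.
    by apply/hasP; exists w0; rewrite ?mem_index_enum.
  rewrite exchange_big /= sumr_const -[_ *+ #|_|]mulr_natl mulrCA mulrA mulr_sumr ltNge.
  case/negP; apply: ler_sum => e eE; rewrite -mulr_sumr mulrC ler_wpM2r // ?freq //.
exists (fun r => if r == N then w else om r) => [r|]; first by case: eqP.
apply: (@le_trans _ _ (\sum_(e in E) (W e + et * (W e * (inc w e)%:R)))).
  apply: ler_sum => e _; rewrite big_ord_recr /= eqxx exprD.
  under eq_bigr => r _ do rewrite (ltn_eqF (ltn_ord r)).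
  rewrite -/(W e) -[X in _ <= X + _]mulr1 mulrCA -mulrDr ler_wpM2l //.
  by case: (inc w e); rewrite ?expr1 ?expr0 ?mulr1 ?mulr0 ?addr0.
rewrite big_split /= -mulr_sumr exprS mulrCA.
apply: (@le_trans _ _ ((1 + et * q) * \sum_(e in E) W e)).
  by rewrite mulrDl mul1r lerD2l -mulrA ler_wpM2l.
by rewrite ler_wpM2l // addr_ge0 // mulr_ge0.
Qed.

Lemma edge_frequency (T V : finType) (a b : nat) (I J : V -> {set T}) (e : {set T}) :
  block_system a b I J -> #|e| = (a + b)%N ->
  \sum_(s : {perm T}) \sum_(q : V * V) (s @: (I q.1 :|: J q.2) == e)%:R =
  #|[set: {perm T}]|%:R * (#|V|%:R ^+ 2 / 'C(#|T|, a + b)%:R) :> R.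
Proof.
move=> [cI cJ dI dJ dIJ] ce; rewrite exchange_big /=.
have one (q : V * V) : \sum_(s : {perm T}) (s @: (I q.1 :|: J q.2) == e)%:R =
    #|[set: {perm T}]|%:R / 'C(#|T|, a + b)%:R :> R.
  have cU : #|I q.1 :|: J q.2| = (a + b)%N.
    by rewrite cardsU (eqP (_ : I q.1 :&: J q.2 == set0)) ?setI_eq0 ?dIJ // cards0 cI cJ subn0.
  have := @sum_perm_on_imset T setT (I q.1 :|: J q.2) (fun Y => (Y == e)%:R) (subsetT _).
  have onT (s : {perm T}) : perm_on setT s by apply/subsetP => x; rewrite inE.
  have cP : #|[set: {perm T}]| = #|[set: T]|`!.
    by rewrite -card_perm; apply: eq_card => s; rewrite inE; symmetry; apply: onT.
  rewrite (eq_bigl _ _ onT) cP cU => ->; rewrite cardsT -[RHS]mulr1; congr (_ * _).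
  rewrite (bigD1 e) /=; last by rewrite subsetT ce eqxx.
  by rewrite eqxx big1 ?addr0 // => Y /andP[_ /negbTE ->].
rewrite (eq_bigr _ (fun q _ => one q)) sumr_const card_prod -[_ *+ _]mulr_natl natrM.
by rewrite expr2; ring.
Qed.

Lemma colour_count (X : finType) (L : nat) (t : X -> 'I_L) (S : {set X}) :
  \sum_(c : {ffun X -> 'I_L}) \prod_(x in S) (c x == t x)%:R =
  #|{ffun X -> 'I_L}|%:R * L%:R ^- #|S| :> R.
Proof.
(* For empty [X] the palette may be empty too; otherwise [t] provides a colour, so [L] is
   positive. *)
have [X0|/card_gt0P[x0 _]] := posnP #|X|.
  have S0 : S = set0 by apply/setP => x; have := fintype0 x X0.
  rewrite S0 cards0 expr0 invr1 mulr1 -sum1_card natr_sum.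
  by apply: eq_bigr => c _; rewrite big_set0.
have L0 : L%:R != 0 :> R by rewrite pnatr_eq0 -lt0n (leq_ltn_trans _ (ltn_ord (t x0))).
pose F (x : X) (a : 'I_L) : R := if x \in S then (a == t x)%:R else 1.
transitivity (\prod_(x : X) \sum_(a : 'I_L) F x a).
  rewrite bigA_distr_bigA; apply: eq_bigr => c _; rewrite big_mkcond.
  by apply: eq_bigr.
have FE x : \sum_(a : 'I_L) F x a = L%:R * (if x \in S then L%:R^-1 else 1).
  rewrite /F; case: (x \in S).
    rewrite divff // (bigD1 (t x)) //= eqxx big1 ?addr0 // => a /negbTE ->.
    by [].
  by rewrite sumr_const card_ord mulr1.
rewrite (eq_bigr _ (fun x _ => FE x)) big_split /= prodr_const -big_mkcond prodr_const.
by rewrite card_ffun card_ord natrX exprVn.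
Qed.

(* The product is expanded into a sum over subsets A of K; each term is the
   probability that the colouring agrees with t on the union of the D j, j in A. *)
Lemma colour_mgf (X V : finType) (L w : nat) (t : X -> 'I_L) (D : V -> {set X})
    (K : {set V}) (mu : R) :
  (forall j, #|D j| = w) -> (forall j j', j != j' -> [disjoint D j & D j']) ->
  \sum_(c : {ffun X -> 'I_L}) \prod_(j in K) (1 + mu * \prod_(x in D j) (c x == t x)%:R)
  = #|{ffun X -> 'I_L}|%:R * (1 + mu * L%:R ^- w) ^+ #|K| :> R.
Proof.
move=> cD dD; pose nu j := if j \in K then mu else 0.
have expand (a : V -> R) : \prod_(j in K) (1 + mu * a j) =
    \sum_(A in {set V}) (\prod_(j in A) nu j) * \prod_(j in A) a j.
  transitivity (\prod_j (nu j * a j + 1)).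
    rewrite big_mkcond; apply: eq_bigr => j _; rewrite /nu.
    by case: (j \in K); rewrite ?mul0r ?add0r // addrC.
  rewrite bigA_distr; apply: eq_bigr => A _.
  by rewrite -big_split /= [RHS]big_mkcond.
under eq_bigr do rewrite expand.
rewrite exchange_big /=.
rewrite -prodr_const (expand (fun=> L%:R ^- w)) mulr_sumr; apply: eq_bigr => A _.
rewrite -mulr_sumr mulrCA; congr (_ * _).
pose D' j := if j \in A then D j else set0.
have dD' j j' : j != j' -> [disjoint D' j & D' j'].
  move=> jj'; rewrite /D'; case: (j \in A); case: (j' \in A); rewrite ?dD //;
    by rewrite -setI_eq0 ?setI0 ?set0I.
transitivity (\sum_(c : {ffun X -> 'I_L}) \prod_(x in \bigcup_j D' j) (c x == t x)%:R : R).
  apply: eq_bigr => c _; rewrite partition_disjoint_bigcup //= big_mkcond.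
  by apply: eq_bigr => j _; rewrite /D'; case: (j \in A); rewrite ?big_set0.
rewrite colour_count prodr_const -exprVn -exprVn -exprM; congr (_ * _ ^+ _).
rewrite -sum1_card partition_disjoint_bigcup //= mulnC -sum_nat_const [RHS]big_mkcond /=.
apply: eq_bigr => j _; rewrite sum1_card /D'.
by case: (j \in A); rewrite ?cD ?cards0.
Qed.
End Selection.

(** * Chernoff bounds for a random colouring *)

Section ColourTails.
Local Open Scope ring_scope.
Variables (X V : finType) (L w : nat) (t : X -> 'I_L) (D : V -> {set X}) (K : {set V}).
Hypothesis cardD : forall j, #|D j| = w.
Hypothesis disjD : forall j j', j != j' -> [disjoint D j & D j'].

Let a (c : {ffun X -> 'I_L}) j : R := \prod_(x in D j) (c x == t x)%:R.
Let rw : R := L%:R ^- w.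

Let a01 c j : a c j = 0 \/ a c j = 1.
Proof.
rewrite /a; have [h|] := boolP [forall x in D j, c x == t x].
  by right; rewrite big1 // => x xD; rewrite (forall_inP h).
rewrite negb_forall_in => /exists_inP[x xD /negbTE h].
by left; rewrite (bigD1 x) //= h mul0r.
Qed.

(** As [a c j] is 0 or 1, [exp (u * a c j)] is exactly [1 + (exp u - 1) * a c j], so the product
    formula applies. For negative [u] the base stays nonnegative because [rw <= 1]. *)
Let colour_exp_sum (u : R) :
  \sum_(c : {ffun X -> 'I_L}) exp (u * \sum_(j in K) a c j) <=
    #|{ffun X -> 'I_L}|%:R * exp ((exp u - 1) * rw * #|K|%:R).
Proof.
have expS c : exp (u * \sum_(j in K) a c j) = \prod_(j in K) (1 + (exp u - 1) * a c j).
  rewrite mulr_sumr; apply: (big_ind2 (fun x y => exp x = y)) => [|x1 x2 y1 y2 <- <-|j _].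
  - exact: expR0.
  - exact: expD.
  by have [->|->] := a01 c j; rewrite ?mulr0 ?mulr1 ?addr0 ?expR0 // addrC subrK.
under eq_bigr do rewrite expS.
rewrite (colour_mgf t K (exp u - 1) cardD disjD) -/rw ler_wpM2l //.
have -> : exp ((exp u - 1) * rw * #|K|%:R) = exp ((exp u - 1) * rw) ^+ #|K|.
  by rewrite expRX mulr_natr.
apply: lerXn2r; rewrite ?nnegrE ?(ltW (exp_gt0 _)) ?exp_ge1Dx //.
have rw0 : 0 <= rw by rewrite invr_ge0 exprn_ge0.
have rw1 : rw <= 1.
  rewrite /rw; have [->|L0] := posnP L; last first.
    by rewrite invf_le1 ?exprn_gt0 ?ltr0n // exprn_ege1 // ler1n.
  by case: w => [|w']; rewrite ?expr0 ?invr1 // expr0n invr0 ler01.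
have : 0 <= exp u * rw by rewrite mulr_ge0 // ltW ?exp_gt0.
by rewrite mulrBl mul1r; lra.
Qed.

(** Chernoff with [u = - th]: per unit of mean the exponent is
    [th * (1 - 4 * th) - th + 2 * th ^+ 2], that is [- 2 * th ^+ 2]. *)
Lemma colour_lower_tail (th : R) : 0 <= th ->
  \sum_(c : {ffun X -> 'I_L})
     (\sum_(j in K) a c j <= (1 - 4 * th) * (rw * #|K|%:R))%R%:R <=
  #|{ffun X -> 'I_L}|%:R * exp (- (2 * th ^+ 2 * (rw * #|K|%:R))).
Proof.
move=> th0; set P := rw * #|K|%:R.
have P0 : 0 <= P by rewrite mulr_ge0 // invr_ge0 exprn_ge0.
have h := colour_exp_sum (- th).
have thN : - th <= 1 / 2 by lra.
have mu := exp_le_quad thN; rewrite sqrrN in mu.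
apply: (@le_trans _ _ (exp (th * ((1 - 4 * th) * P)) *
   \sum_(c : {ffun X -> 'I_L}) exp (- th * \sum_(j in K) a c j))).
  rewrite mulr_sumr; apply: ler_sum => c _; rewrite -expD.
  case: (boolP (_ <= _ * P)) => [le|_]; last by rewrite ltW ?exp_gt0.
  apply: (@le_trans _ _ (exp 0)); [by rewrite expR0 | apply: ler_exp];
  rewrite mulNr -mulrBr mulr_ge0 // subr_ge0; exact: le.
apply: (@le_trans _ _ (exp (th * ((1 - 4 * th) * P)) *
   (#|{ffun X -> 'I_L}|%:R * exp ((exp (- th) - 1) * rw * #|K|%:R)))).
  by rewrite ler_wpM2l // ltW ?exp_gt0.
rewrite mulrCA -expD ler_wpM2l // ler_exp // -mulrA -/P.
have : 0 <= (1 - th + 2 * th ^+ 2 - exp (- th)) * P by rewrite mulr_ge0 // subr_ge0.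
by rewrite expr2; lra.
Qed.

Lemma colour_upper_tail (th M : R) : 0 <= th -> th <= 1 / 2 -> #|K|%:R <= M ->
  \sum_(c : {ffun X -> 'I_L})
     ((1 + 4 * th) * (rw * M) <= \sum_(j in K) a c j)%R%:R <=
  #|{ffun X -> 'I_L}|%:R * exp (- (2 * th ^+ 2 * (rw * M))).
Proof.
move=> th0 th2 KM; set P := rw * M.
have rw0 : 0 <= rw by rewrite invr_ge0 exprn_ge0.
have P0 : 0 <= P by rewrite mulr_ge0 // (le_trans _ KM).
have h := colour_exp_sum th.
have mu := exp_le_quad th2.
have mu0 : 0 <= exp th - 1 by have := exp_ge1Dx th; lra.
apply: (@le_trans _ _ (exp (- th * ((1 + 4 * th) * P)) *
   \sum_(c : {ffun X -> 'I_L}) exp (th * \sum_(j in K) a c j))).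
  rewrite mulr_sumr; apply: ler_sum => c _; rewrite -expD.
  case: (boolP (_ * P <= _)) => [le|_]; last by rewrite ltW ?exp_gt0.
  apply: (@le_trans _ _ (exp 0)); [by rewrite expR0 | apply: ler_exp];
  rewrite mulNr addrC -mulrBr mulr_ge0 // subr_ge0; exact: le.
apply: (@le_trans _ _ (exp (- th * ((1 + 4 * th) * P)) *
   (#|{ffun X -> 'I_L}|%:R * exp ((exp th - 1) * rw * #|K|%:R)))).
  by rewrite ler_wpM2l // ltW ?exp_gt0.
rewrite mulrCA -expD ler_wpM2l // ler_exp //.
have : 0 <= (exp th - 1) * rw * (M - #|K|%:R) by rewrite !mulr_ge0 // subr_ge0.
have : 0 <= (1 + th + 2 * th ^+ 2 - exp th) * P by rewrite mulr_ge0 // subr_ge0.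
by rewrite /P expr2; lra.
Qed.
End ColourTails.

Lemma block_edge_inj (T V : finType) (a b : nat) (I J : V -> {set T}) (s : {perm T}) :
  block_system a b I J -> 0 < a -> 0 < b ->
  injective (fun q : V * V => s @: (I q.1 :|: J q.2)).
Proof.
move=> [cI cJ dI dJ dIJ] a0 b0 [i j] [i' j'] /imset_inj-/(_ perm_inj) /= e.
have /card_gt0P[x xI] : 0 < #|I i| by rewrite cI.
have /card_gt0P[y yJ] : 0 < #|J j| by rewrite cJ.
have ei : i = i'.
  have : x \in I i' :|: J j' by rewrite -e inE xI.
  rewrite inE (disjointFr (dIJ i j') xI) orbF => xI'.
  by apply/eqP; apply: contraTT xI' => /dI d; rewrite (disjointFr d xI).
have ej : j = j'.
  have : y \in I i' :|: J j' by rewrite -e inE yJ orbT.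
  rewrite inE (disjointFl (dIJ i' j) yJ) => yJ'.
  by apply/eqP; apply: contraTT yJ' => /dJ d; rewrite (disjointFr d yJ).
by rewrite ei ej.
Qed.

(** * Edge-disjoint splitting by a random colouring *)

Section ColourSplit.
Local Open Scope ring_scope.
Variables (T V : finType) (a b N L : nat) (E : {set {set T}}).
Variables (I J : V -> {set T}) (om : nat -> {perm T}) (lo hi th be : R).
Hypothesis sys : block_system a b I J.
Hypothesis a0 : (0 < a)%N.
Hypothesis b0 : (0 < b)%N.
Hypothesis th0 : 0 <= th.
Hypothesis th4 : th <= 1 / 4.
Hypothesis om_good : forall r, well_spread (bip_of E I J (om r)) lo hi.

Let edge r (q : V * V) : {set T} := om r @: (I q.1 :|: J q.2).

Definition appears r (e : {set T}) : bool := [exists q : V * V, edge r q == e].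

Hypothesis cover_le : forall e, e \in E -> (\sum_(r < N) appears r e <= L.+1)%N.
Hypothesis tail_lo : exp (- (2 * th ^+ 2 * (L.+1%:R^-1 * lo))) <= be.
Hypothesis tail_hi : exp (- (2 * th ^+ 2 * (L.+1%:R ^- 2 * hi))) <= be.
Hypothesis few : N%:R * ((2 * #|V|%:R + #|V|%:R ^+ 2) * be) < 1.

(* The colour of an edge e is the rank, among the graphs containing e, of the
   graph to which e is given; there are at most L + 1 of them. *)
Let rank r e : nat := \sum_(r' < r) appears r' e.
Let t r (e : {set T}) : 'I_L.+1 := inord (rank r e).
Let B (c : {ffun {set T} -> 'I_L.+1}) r : {set V * V} :=
  [set q in bip_of E I J (om r) | c (edge r q) == t r (edge r q)].

Let edge_inj r : injective (edge r).
Proof. exact: block_edge_inj sys a0 b0. Qed.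

Let rank_lt r r' e : (r < r')%N -> appears r e -> (rank r e < rank r' e)%N.
Proof.
move=> rr' ap; rewrite /rank -!(big_mkord xpredT (fun r => appears r e : nat)).
rewrite [X in (_ < X)%N](big_cat_nat (n := r.+1)) //= big_nat_recr //= ap; lia.
Qed.

(** Ranks stay in the range of [inord], so equal colours mean equal ranks. *)
Let rank_ltL r e : (r < N)%N -> e \in E -> appears r e -> (rank r e < L.+1)%N.
Proof. by move=> rN eE ap; apply: leq_trans (rank_lt rN ap) (cover_le eE). Qed.

(** Degrees and codegrees are written as sums over disjoint sets of one or two edges, the form in
    which the colour tails apply with [w] equal to 1 or 2. *)
Let B_degl c r i : (bip_edges (B c r) [set i] setT)%:R =
  \sum_(j in [set j | (i, j) \in bip_of E I J (om r)])
     \prod_(x in [set edge r (i, j)]) (c x == t r x)%:R :> R.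
Proof.
rewrite bip_edgesE [RHS]big_mkcond; apply: eq_big => [j|j _]; rewrite ?inE // !big_set1 !inE.
by case: (_ \in E).
Qed.

Let B_degr c r j : (bip_edges (B c r) setT [set j])%:R =
  \sum_(i in [set i | (i, j) \in bip_of E I J (om r)])
     \prod_(x in [set edge r (i, j)]) (c x == t r x)%:R :> R.
Proof.
rewrite bip_edgesE big_set1 [RHS]big_mkcond.
apply: eq_big => [i|i _]; first by rewrite inE.
by rewrite big_set1 !inE /=; case: (_ \in E).
Qed.

Let B_codeg c r i i' : i != i' -> (bip_codeg (B c r) i i')%:R =
  \sum_(j in [set j | ((i, j) \in bip_of E I J (om r)) && ((i', j) \in bip_of E I J (om r))])
     \prod_(x in [set edge r (i, j); edge r (i', j)]) (c x == t r x)%:R :> R.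
Proof.
move=> ii'; rewrite /bip_codeg cardsE -sum1_card natr_sum [RHS]big_mkcond [LHS]big_mkcond /=.
apply: eq_bigr => j _; rewrite unfold_in !inE /=.
rewrite big_setU1 ?big_set1; last first.
  by rewrite inE (inj_eq (@edge_inj r)) xpair_eqE (negbTE ii').
rewrite /edge /=; case: (_ \in E); case: (_ \in E); case: (c _ == _); case: (c _ == _) => //=;
  by rewrite ?mulr0 ?mul0r ?mulr1.
Qed.

Let L0 : 0 <= L.+1%:R^-1 :> R.
Proof. by rewrite invr_ge0. Qed.

Let one_fails r :
  \sum_(c : {ffun {set T} -> 'I_L.+1}) (~~ well_spread (B c r)
      ((1 - 4 * th) * (L.+1%:R^-1 * lo)) ((1 + 4 * th) * (L.+1%:R ^- 2 * hi)))%:R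
  <= (2 * #|V|%:R + #|V|%:R ^+ 2) * (#|{ffun {set T} -> 'I_L.+1}|%:R * be).
Proof.
have th14 : 0 <= 1 - 4 * th by have h := th4; lra.
have th12 : th <= 1 / 2 by have h := th4; lra.
have sq0 : 0 <= 2 * th ^+ 2 by rewrite mulr_ge0 ?sqr_ge0.
have /and3P[/forallP gl /forallP gr /forallP gc] := om_good r.
have tail_ge (x : R) : lo <= x -> exp (- (2 * th ^+ 2 * (L.+1%:R ^- 1 * x))) <= be.
  move=> lox; apply: le_trans tail_lo; rewrite ler_exp // lerN2 ler_wpM2l // expr1.
  by rewrite ler_wpM2l.
apply: well_spread_union.
- by rewrite mulr_ge0 // (le_trans _ tail_lo) // ltW ?exp_gt0.
- move=> i; set K := [set j | (i, j) \in bip_of E I J (om r)].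
  have cK : #|K|%:R = (bip_edges (bip_of E I J (om r)) [set i] setT)%:R :> R.
    rewrite bip_edgesE -sum1_card natr_sum [LHS]big_mkcond.
    apply: eq_big => [j|j _]; first by rewrite inE.
    by rewrite big_set1 inE; case: (_ \in bip_of _ _ _ _).
  have lK : lo <= #|K|%:R by rewrite cK.
  apply: (@le_trans _ _ _ _ _ _ (ler_wpM2l (ler0n _ _) (tail_ge _ lK))).
  have d1 j : #|[set edge r (i, j)]| = 1%N by rewrite cards1.
  have d2 j j' : j != j' -> [disjoint [set edge r (i, j)] & [set edge r (i, j')]].
    by move=> jj'; rewrite disjoints1 inE (inj_eq (@edge_inj r)) xpair_eqE eqxx.
  apply: le_trans (colour_lower_tail (t r) K d1 d2 th0).
  apply: ler_sum => c _; rewrite ler_nat B_degl.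
  case: (boolP (_ <= (1 - 4 * th) * (_ * lo))) => // h; rewrite lt0b (le_trans h) //.
  by rewrite ler_wpM2l // expr1 ler_wpM2l.
- move=> j; set K := [set i | (i, j) \in bip_of E I J (om r)].
  have cK : #|K|%:R = (bip_edges (bip_of E I J (om r)) setT [set j])%:R :> R.
    rewrite bip_edgesE big_set1 -sum1_card natr_sum [LHS]big_mkcond.
    apply: eq_big => [i|i _]; first by rewrite inE.
    by rewrite inE; case: (_ \in bip_of _ _ _ _).
  have lK : lo <= #|K|%:R by rewrite cK.
  apply: (@le_trans _ _ _ _ _ _ (ler_wpM2l (ler0n _ _) (tail_ge _ lK))).
  have d1 i : #|[set edge r (i, j)]| = 1%N by rewrite cards1.
  have d2 i i' : i != i' -> [disjoint [set edge r (i, j)] & [set edge r (i', j)]].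
    by move=> ii'; rewrite disjoints1 inE (inj_eq (@edge_inj r)) xpair_eqE eqxx andbT.
  apply: le_trans (colour_lower_tail (t r) K d1 d2 th0).
  apply: ler_sum => c _; rewrite ler_nat B_degr.
  case: (boolP (_ <= (1 - 4 * th) * (_ * lo))) => // h; rewrite lt0b (le_trans h) //.
  by rewrite ler_wpM2l // expr1 ler_wpM2l.
move=> i i' ii'.
set K := [set j | ((i, j) \in bip_of E I J (om r)) && ((i', j) \in bip_of E I J (om r))].
have hK : #|K|%:R <= hi.
  by have /forallP/(_ i') := gc i; rewrite ii'.
apply: (@le_trans _ _ _ _ _ _ (ler_wpM2l (ler0n _ _) tail_hi)).
have neq j j' : edge r (i, j) != edge r (i', j').
  by rewrite (inj_eq (@edge_inj r)) xpair_eqE (negbTE ii').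
have d1 j : #|[set edge r (i, j); edge r (i', j)]| = 2%N by rewrite cards2 neq.
have d2 j j' : j != j' ->
  [disjoint [set edge r (i, j); edge r (i', j)] & [set edge r (i, j'); edge r (i', j')]].
  move=> jj'; rewrite -setI_eq0 setIUl setU_eq0 !setI_eq0 !disjoints1 !inE !negb_or neq.
  rewrite [edge r (i', j) == edge r (i, j')]eq_sym (negbTE (neq _ _)) /=.
  by rewrite !(inj_eq (@edge_inj r)) !xpair_eqE !eqxx (negbTE jj').
apply: le_trans (colour_upper_tail (t r) d1 d2 th0 th12 hK).
by apply: ler_sum => c _; rewrite ler_nat B_codeg.
Qed.

(** The degree bounds come from a union bound over the [N] graphs; edge-disjointness is
    deterministic, since a common edge would have the same rank in two graphs containing it, while
    ranks increase strictly. *)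
Lemma colour_split : exists G : nat -> {set V * V},
  [/\ forall r, (r < N)%N -> G r \subset bip_of E I J (om r),
      forall r r' q q', (r < r')%N -> (r' < N)%N -> q \in G r -> q' \in G r' ->
        edge r q != edge r' q' &
      forall r, (r < N)%N ->
        well_spread (G r) ((1 - 4 * th) * (L.+1%:R^-1 * lo))
          ((1 + 4 * th) * (L.+1%:R ^- 2 * hi))].
Proof.
have [c cgood] : exists c, forall r : 'I_N, well_spread (B c r)
    ((1 - 4 * th) * (L.+1%:R^-1 * lo)) ((1 + 4 * th) * (L.+1%:R ^- 2 * hi)).
  suff /existsP[c /forallP h] : [exists c, [forall r : 'I_N, well_spread (B c r)
    ((1 - 4 * th) * (L.+1%:R^-1 * lo)) ((1 + 4 * th) * (L.+1%:R ^- 2 * hi))]] by exists c.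
  apply: contraT => /existsPn no.
  have C0 : 0 < #|{ffun {set T} -> 'I_L.+1}|%:R :> R.
    by rewrite ltr0n card_ffun card_ord expn_gt0.
  have : #|{ffun {set T} -> 'I_L.+1}|%:R <= \sum_(r < N) \sum_(c : {ffun {set T} -> 'I_L.+1})
      (~~ well_spread (B c r) ((1 - 4 * th) * (L.+1%:R^-1 * lo))
          ((1 + 4 * th) * (L.+1%:R ^- 2 * hi)))%:R :> R.
    rewrite exchange_big -sum1_card natr_sum /=; apply: ler_sum => c _.
    have /forallPn[r bad] := no c.
    by rewrite (bigD1 r) //= bad lerDl sumr_ge0.
  have up : \sum_(r < N) \sum_(c : {ffun {set T} -> 'I_L.+1})
      (~~ well_spread (B c r) ((1 - 4 * th) * (L.+1%:R^-1 * lo))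
          ((1 + 4 * th) * (L.+1%:R ^- 2 * hi)))%:R <=
      #|{ffun {set T} -> 'I_L.+1}|%:R * (N%:R * ((2 * #|V|%:R + #|V|%:R ^+ 2) * be)) :> R.
    apply: (@le_trans _ _ (\sum_(r < N) (2 * #|V|%:R + #|V|%:R ^+ 2) *
        (#|{ffun {set T} -> 'I_L.+1}|%:R * be))); first by apply: ler_sum => r _.
    by rewrite sumr_const card_ord -[_ *+ N]mulr_natl le_eqVlt; apply/orP; left; apply/eqP; ring.
  move=> /le_trans/(_ up); rewrite -[leLHS]mulr1 ler_pM2l // leNgt.
  by move/negP; case; exact: few.
exists (B c); split => [r rN|r r' q q' rr' r'N|r rN].
- by apply/subsetP => q; rewrite inE => /andP[].
- rewrite !inE => /andP[qE /eqP cq] /andP[q'E /eqP cq'].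
  apply/eqP => e; rewrite -e cq in cq'.
  have ap : appears r (edge r q) by apply/existsP; exists q.
  have ap' : appears r' (edge r q) by apply/existsP; exists q'; rewrite -e.
  have := congr1 val cq'; rewrite /= !inordK ?rank_ltL ?(ltn_trans rr') //.
  by move=> er; have := rank_lt rr' ap; rewrite er ltnn.
exact: (cgood (Ordinal rN)).
Qed.
End ColourSplit.

(** * From bipartite matchings to perfect matchings *)

(** The points are [i * (a + b) + u]; remainders [u] below [a] form [I i], the others [J i]. *)
Lemma block_system_ord (a b v n : nat) : n = (a + b) * v ->
  exists I J : 'I_v -> {set 'I_n}, block_system a b I J.
Proof.
move=> nE.
have lt (i : 'I_v) u : u < a + b -> i * (a + b) + u < n.
  move=> ul; rewrite nE [X in _ < X]mulnC; apply: (@leq_trans (i.+1 * (a + b))).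
    by rewrite mulSnr; lia.
  by rewrite leq_mul2r ltn_ord orbT.
have ltI (u : 'I_a) : u < a + b by have := ltn_ord u; lia.
have ltJ (u : 'I_b) : a + u < a + b by rewrite ltn_add2l.
pose fI i (u : 'I_a) := Ordinal (lt i _ (ltI u)).
pose fJ i (u : 'I_b) := Ordinal (lt i _ (ltJ u)).
have divmod i u : u < a + b -> (i * (a + b) + u) %/ (a + b) = i /\ (i * (a + b) + u) %% (a + b) = u.
  move=> ul; have ab : 0 < a + b by lia.
  by rewrite divnMDl // divn_small // addn0 modnMDl modn_small.
have eqn i u i' u' : u < a + b -> u' < a + b ->
    i * (a + b) + u = i' * (a + b) + u' -> i = i' /\ u = u'.
  move=> ul u'l e; have [d1 m1] := divmod i u ul; have [d2 m2] := divmod i' u' u'l.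
  by split; [rewrite -d1 e d2 | rewrite -m1 e m2].
exists (fun i => fI i @: setT), (fun i => fJ i @: setT); split.
- move=> i; rewrite card_imset ?cardsT ?card_ord // => u u' /(congr1 val) /= e.
  by apply: val_inj; have [] := eqn _ _ _ _ (ltI u) (ltI u') e.
- move=> i; rewrite card_imset ?cardsT ?card_ord // => u u' /(congr1 val) /= e.
  by apply: val_inj; have [_ /addnI] := eqn _ _ _ _ (ltJ u) (ltJ u') e.
- move=> i i' ii'; apply/pred0P => x; apply/negP => /andP[/imsetP[u _ ->] /imsetP[u' _]].
  move=> /(congr1 val) /= e; have [/val_inj ei _] := eqn _ _ _ _ (ltI u) (ltI u') e.
  by rewrite ei eqxx in ii'.
- move=> i i' ii'; apply/pred0P => x; apply/negP => /andP[/imsetP[u _ ->] /imsetP[u' _]].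
  move=> /(congr1 val) /= e; have [/val_inj ei _] := eqn _ _ _ _ (ltJ u) (ltJ u') e.
  by rewrite ei eqxx in ii'.
move=> i j; apply/pred0P => x; apply/negP => /andP[/imsetP[u _ ->] /imsetP[u' _]].
move=> /(congr1 val) /= e; have [_] := eqn _ _ _ _ (ltI u) (ltJ u') e.
by have := ltn_ord u; lia.
Qed.

Section Packing.
Variables (n a b N r0 : nat) (V : finType) (E : {set {set 'I_n}}).
Variables (I J : V -> {set 'I_n}).
Hypothesis sys : block_system a b I J.
Hypothesis a0 : 0 < a.
Hypothesis b0 : 0 < b.
Hypothesis nE : n = (a + b) * #|[set: V]|.
Hypothesis n0 : 0 < n.

Let edge (s : {perm 'I_n}) (q : V * V) := s @: (I q.1 :|: J q.2).

Let card_edge s q : #|edge s q| = a + b.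
Proof.
have [cI cJ _ _ dIJ] := sys.
rewrite card_imset; last exact: perm_inj.
by rewrite cardsU (eqP (_ : I q.1 :&: J q.2 == set0)) ?setI_eq0 ?dIJ // cards0 cI cJ subn0.
Qed.

Lemma regular1_card (M : {set V * V}) : bip_regular 1 M -> #|M| = #|[set: V]|.
Proof.
move=> [Mx _]; have : bip_edges M setT setT = #|[set: V]|.
  by rewrite bip_edges_suml (eq_bigr (fun=> 1)) ?sum1_card // => x _; rewrite Mx.
by rewrite /bip_edges; under eq_bigr do rewrite !inE; rewrite sum1_card.
Qed.

Lemma regular1_inj (M : {set V * V}) q q' : bip_regular 1 M ->
  q \in M -> q' \in M -> q != q' -> q.1 != q'.1 /\ q.2 != q'.2.
Proof.
move=> [Mx My] qM q'M qq'; split; apply/eqP => e.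
  have := Mx q.1; rewrite /bip_edges (bigD1 q) //= (bigD1 q') /=; last by rewrite q'M eq_sym.
  by rewrite !inE e eqxx.
have := My q.2; rewrite /bip_edges (bigD1 q) //= (bigD1 q') /=; last by rewrite q'M eq_sym.
by rewrite !inE e eqxx.
Qed.

Lemma perfect_matching_of (s : {perm 'I_n}) (M : {set V * V}) :
  M \subset bip_of E I J s -> bip_regular 1 M ->
  perfect_matching (a + b) E [set edge s q | q in M].
Proof.
move=> MB M1; have [cI cJ dI dJ dIJ] := sys.
have injE := block_edge_inj (s := s) sys a0 b0.
have dis e f : e \in [set edge s q | q in M] -> f \in [set edge s q | q in M] ->
    e != f -> [disjoint e & f].
  move=> /imsetP[q qM ->] /imsetP[q' q'M ->] ef.
  have [|n1 n2] := regular1_inj M1 qM q'M; first by apply: contraNneq ef => ->.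
  rewrite -setI_eq0 -imsetI; last by move=> x y _ _; apply: perm_inj.
  rewrite (eqP (_ : (I q.1 :|: J q.2) :&: (I q'.1 :|: J q'.2) == set0)) ?imset0 //.
  rewrite setIUl !setIUr !setU_eq0 !setI_eq0 dI // dIJ dJ //.
  by rewrite disjoint_sym dIJ.
have cM : #|[set edge s q | q in M]| = #|[set: V]|.
  by rewrite card_imset // regular1_card.
split; last split; last split => //.
- apply/subsetP => e /imsetP[q /(subsetP MB)]; by rewrite inE => qE ->.
- by rewrite cM nE mulKn //; lia.
(* Coverage by counting: [#|[set: V]|] disjoint edges of size [a + b] have [n] points together. *)
apply/eqP; rewrite eqEcard subsetT /= cardsT card_ord.
have /eqP <- : trivIset [set edge s q | q in M].
  by apply/trivIsetP => e f eM fM; apply: dis.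
rewrite (eq_bigr (fun=> a + b)) => [|e /imsetP[q _ ->]]; last exact: card_edge.
by rewrite sum_nat_const cM mulnC -nE.
Qed.

Lemma packing (om : nat -> {perm 'I_n}) (G : nat -> {set V * V}) :
  (forall r, r < N -> G r \subset bip_of E I J (om r)) ->
  (forall r r' q q', r < r' -> r' < N -> q \in G r -> q' \in G r' ->
     edge (om r) q != edge (om r') q') ->
  (forall r, r < N -> bip_cond r0 (G r)) ->
  exists F : {set {set {set 'I_n}}},
    [/\ forall M, M \in F -> perfect_matching (a + b) E M,
        forall M1 M2, M1 \in F -> M2 \in F -> M1 != M2 -> [disjoint M1 & M2] &
        #|F| = N * r0].
Proof.
move=> GB Gdis Gc.
have [M MP] : exists M : 'I_N -> nat -> {set V * V}, forall r : 'I_N,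
    (forall i, i < r0 -> M r i \subset G r /\ bip_regular 1 (M r i)) /\
    (forall i j, i < j -> j < r0 -> [disjoint M r i & M r j]).
  by apply: (fin_all_exists (fun r : 'I_N => bip_disjoint_matchings (Gc r (ltn_ord r)))).
pose P (q : 'I_N * 'I_r0) := [set edge (om q.1) p | p in M q.1 q.2].
have pm q : perfect_matching (a + b) E (P q).
  have [/(_ q.2 (ltn_ord _))[sM rM] _] := MP q.1.
  by apply: perfect_matching_of rM; apply: subset_trans sM (GB _ (ltn_ord _)).
have Pdis q q' : q != q' -> [disjoint P q & P q'].
  have Msub (u : 'I_N * 'I_r0) p : p \in M u.1 u.2 -> p \in G u.1.
    by have [/(_ u.2 (ltn_ord _))[/subsetP sM _] _] := MP u.1; apply: sM.
  move=> qq'; apply/pred0P => e /=; apply/negP => /andP[/imsetP[p pM ->] /imsetP[p' p'M ee]].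
  have [eq1|ne1] := eqVneq q.1 q'.1.
    have ne2 : q.2 != q'.2.
      by apply: contraNneq qq' => eq2; rewrite [q]surjective_pairing eq1 eq2 -surjective_pairing.
    have pp : p = p' by apply: (block_edge_inj (s := om q.1) sys a0 b0); rewrite /= -/(edge _ _) ee eq1.
    have [_ d] := MP q.1.
    have : [disjoint M q.1 q.2 & M q.1 q'.2].
      have [lt|lt|e2] := ltngtP q.2 q'.2; first exact: d.
        by rewrite disjoint_sym; apply: d.
      by move/val_inj: e2 ne2 => ->; rewrite eqxx.
    by move=> /disjointFr/(_ pM); rewrite pp eq1 p'M.
  have [lt|lt|e1] := ltngtP q.1 q'.1.
  - by have := Gdis _ _ p p' lt (ltn_ord _) (Msub _ _ pM) (Msub _ _ p'M); rewrite ee eqxx.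
  - by have := Gdis _ _ p' p lt (ltn_ord _) (Msub _ _ p'M) (Msub _ _ pM); rewrite ee eqxx.
  by move/val_inj: e1 ne1 => ->; rewrite eqxx.
(* Disjoint nonempty sets are distinct, so [P] is injective and the size of the family is exactly
   [N * r0]. *)
have Pn0 q : P q != set0.
  rewrite -card_gt0; have [_ [-> _]] := pm q.
  have /andP[ab V0] : (0 < a + b) && (0 < #|[set: V]|) by rewrite -muln_gt0 -nE.
  by rewrite nE mulKn.
have Pinj : injective P.
  move=> q q' e; apply/eqP; apply: contraNT (Pn0 q) => /Pdis.
  by rewrite -e -setI_eq0 setIid.
exists (P @: setT); split.
- by move=> _ /imsetP[q _ ->].
- move=> _ _ /imsetP[q _ ->] /imsetP[q' _ ->] PP; apply: Pdis.
  by apply: contraNneq PP => ->.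
by rewrite card_imset // cardsT card_prod !card_ord.
Qed.
End Packing.

(** * Choice of the parameters *)

Section Numerics.
Local Open Scope ring_scope.

Lemma num_eps_le_eta (th : R) : 0 < th -> th <= 1 / 28 -> th ^+ 3 <= th / 50.
Proof.
move=> h0 h1; rewrite exprS ler_pM2l //.
by rewrite expr2; apply: (@le_trans _ _ (1 / 28 * (1 / 28))); [rewrite ler_pM // ltW | lra].
Qed.

Variables (k n l p et : R).
Hypothesis k2 : 2 <= k.
Hypothesis n0 : 0 < n.
Hypothesis l1 : 1 <= l.
Hypothesis p0 : 0 < p.
Hypothesis p1 : p <= 1.
Hypothesis et0 : 0 < et.
Hypothesis et1 : et <= 1.
Hypothesis big : 64 * k ^+ 3 * (k + 5) * l ^+ 10 <= et ^+ 6 * n * p ^+ 4.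

Let k0 : 0 < k. Proof. exact: lt_le_trans k2. Qed.
Let l0 : 0 < l. Proof. exact: lt_le_trans l1. Qed.

Let big_le i (x : R) : (i <= 6)%N -> x <= 64 * k ^+ 3 * (k + 5) ->
  x * l <= et ^+ i * n * p ^+ 4.
Proof.
move=> i6 xB; apply: le_trans (_ : et ^+ 6 * n * p ^+ 4 <= _); last first.
  by rewrite !ler_wpM2r ?exprn_ge0 ?(ltW n0) ?(ltW p0) // ler_wiXn2l // ltW.
apply: le_trans big; have B0 : 0 <= 64 * k ^+ 3 * (k + 5).
  have h := k0.
  by rewrite !mulr_ge0 ?exprn_ge0 // ?addr_ge0 // ltW.
apply: (@le_trans _ _ (64 * k ^+ 3 * (k + 5) * l)).
  by rewrite ler_wpM2r // ltW.
by rewrite ler_wpM2l // -[leLHS]expr1 ler_weXn2l.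
Qed.

Let kB i : (i <= 2)%N -> 512 * k ^+ i <= 64 * k ^+ 3 * (k + 5).
Proof.
move=> i2; have h := k2.
have ki : k ^+ i <= k ^+ 2 by rewrite ler_weXn2l // (le_trans _ h) // ler1n.
have k20 : 0 <= k ^+ 2 by apply: sqr_ge0.
have : 0 <= k ^+ 2 * (k * (k + 5) - 14) by rewrite mulr_ge0 //; nra.
by rewrite [k ^+ 3]exprSr; lra.
Qed.

Let p4le : p ^+ 4 <= 1. Proof. by rewrite exprn_ile1 // ltW. Qed.

Lemma num_perm_tail : 512 * k ^+ 2 * l <= et ^+ 2 * n * p ^+ 4.
Proof. by apply: big_le => //; apply: kB. Qed.

Lemma num_eta_n : 1 <= et * n.
Proof.
have h : 512 * 1 * l <= et ^+ 1 * n * p ^+ 4 by apply: big_le => //; apply: (kB (i := 0)).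
have := l1; have : et * n * p ^+ 4 <= et * n.
  by rewrite -[leRHS]mulr1 ler_wpM2l // mulr_ge0 // ltW.
by rewrite expr1 in h; lra.
Qed.

Lemma num_colours : 4 * k * l / et ^+ 2 <= n.
Proof.
rewrite ler_pdivrMr ?exprn_gt0 //.
have h : 4 * k * l <= et ^+ 2 * n * p ^+ 4.
  by apply: big_le => //; have := kB (i := 1) isT; have := k0; rewrite expr1; lra.
apply: le_trans h _; have -> : n * et ^+ 2 = et ^+ 2 * n * 1 by ring.
by rewrite ler_wpM2l // mulr_ge0 ?exprn_ge0 // ltW.
Qed.

(** The origin of [et ^+ 6]: for the largest admissible [L] this reads [16 * k ^+ 3 * (k + 5) * l ^+
    3 <= et ^+ 6 * n * p ^+ 2]. *)
Lemma num_colour_tail (L : R) : 0 < L -> L <= 4 * k * l / et ^+ 2 ->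
  (k + 5) * l <= et ^+ 2 * p ^+ 2 * (n / k) / L ^+ 2.
Proof.
move=> L0; rewrite ler_pdivlMr ?exprn_gt0 // => hL.
have kn0 := k0; have ln0 := l0.
rewrite ler_pdivlMr ?exprn_gt0 // mulrA ler_pdivlMr //.
rewrite -(ler_pM2r (exprn_gt0 4 et0)).
have sq : (L * et ^+ 2) ^+ 2 <= (4 * k * l) ^+ 2.
  by rewrite lerXn2r ?nnegrE ?mulr_ge0 ?exprn_ge0 // ltW.
have c0 : 0 <= (k + 5) * l * k by rewrite !mulr_ge0 ?addr_ge0 // ltW.
have h1 := ler_wpM2l c0 sq.
have h2 : (k + 5) * l * k * (4 * k * l) ^+ 2 <= 64 * k ^+ 3 * (k + 5) * l ^+ 10.
  have -> : (k + 5) * l * k * (4 * k * l) ^+ 2 = 16 * k ^+ 3 * (k + 5) * l ^+ 3 by ring.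
  have a0 : 0 <= k ^+ 3 * (k + 5) by rewrite !mulr_ge0 ?exprn_ge0 ?addr_ge0 // ltW.
  have l3 : l ^+ 3 <= l ^+ 10 by rewrite ler_weXn2l.
  have l30 : 0 <= l ^+ 3 by rewrite exprn_ge0 // ltW.
  have := ler_wpM2l a0 l3; have : 0 <= k ^+ 3 * (k + 5) * l ^+ 3 by rewrite mulr_ge0.
  by lra.
have h3 : et ^+ 6 * n * p ^+ 4 <= et ^+ 2 * p ^+ 2 * n * et ^+ 4.
  have -> : et ^+ 2 * p ^+ 2 * n * et ^+ 4 = et ^+ 6 * n * p ^+ 2 by ring.
  by rewrite ler_wpM2l ?mulr_ge0 ?exprn_ge0 ?(ltW n0) ?(ltW et0) // ler_wiXn2l // ltW.
have := le_trans (le_trans h1 h2) (le_trans big h3).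
have -> : (k + 5) * l * L ^+ 2 * k * et ^+ 4 = (k + 5) * l * k * (L * et ^+ 2) ^+ 2 by ring.
by [].
Qed.
End Numerics.

Lemma leq_bin_expn n k : 'C(n, k) <= n ^ k.
Proof.
have h : n ^_ k <= n ^ k.
  elim: k n => [|k IH] n; first by rewrite ffactn0 expn0.
  rewrite ffactnS expnS leq_mul2l; apply/orP; right.
  apply: leq_trans (IH n.-1) _; case: k {IH} => [|k]; first by rewrite !expn0.
  by rewrite leq_exp2r ?leq_pred.
apply: leq_trans h; rewrite -bin_ffact leq_pmulr //; exact: fact_gt0.
Qed.

(** * Selecting good permutations that cover no edge too often *)

Section Assembly.
Local Open Scope ring_scope.

Lemma exp_le_1D (et : R) : 0 <= et -> exp (et - et ^+ 2) <= 1 + et.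
Proof.
move=> et0; set x := et - et ^+ 2.
have h : 0 < 1 - x by rewrite /x expr2; nra.
have h1 : exp x * (1 - x) <= 1.
  apply: (@le_trans _ _ (exp x * exp (- x))).
    by rewrite ler_wpM2l ?(ltW (exp_gt0 _)) // exp_ge1Dx.
  by rewrite -expD subrr expR0.
rewrite -(ler_pM2r h); apply: le_trans h1 _.
have -> : (1 + et) * (1 - x) = 1 + et ^+ 3 by rewrite /x; ring.
by rewrite lerDl exprn_ge0.
Qed.

(** This gives [q <= 1], so rounding [N] down costs at most one in [N * q]. *)
Lemma block_count_le (T V : finType) (a b : nat) (I J : V -> {set T}) :
  block_system a b I J -> (0 < a)%N -> (0 < b)%N -> (#|V| ^ 2 <= 'C(#|T|, a + b))%N.
Proof.
move=> sys a0 b0; have [cI cJ dI dJ dIJ] := sys.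
have inj := block_edge_inj (s := 1%g) sys a0 b0.
have -> : (#|V| ^ 2)%N = #|[set (1%g : {perm T}) @: (I q.1 :|: J q.2) | q in [set: V * V]]|.
  by rewrite card_imset // cardsT card_prod.
rewrite -card_draws; apply: subset_leq_card; apply/subsetP => A /imsetP[q _ ->].
rewrite inE card_imset; last exact: perm_inj.
by rewrite cardsU (eqP (_ : I q.1 :&: J q.2 == set0)) ?setI_eq0 ?dIJ // cards0 cI cJ subn0.
Qed.

(** Restricting to [Gd] raises the frequency of an edge from [q] to at most [q / (1 - et)]. An edge
    covered more than [L.+1] times would alone weigh at least [(1 + et) ^+ L.+2], more than the last
    hypothesis allows for the total weight. *)
Lemma selected_perms (T V : finType) (a b N L : nat) (I J : V -> {set T})
    (E : {set {set T}}) (Gd : {set {perm T}}) (et : R)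
    (q : R := #|V|%:R ^+ 2 / 'C(#|T|, a + b)%:R) :
  block_system a b I J -> (forall e, e \in E -> #|e| = (a + b)%N) ->
  0 < et -> et < 1 -> (1 - et) * #|[set: {perm T}]|%:R <= #|Gd|%:R ->
  #|E|%:R * exp (et * (q / (1 - et)) * N%:R) <= exp ((et - et ^+ 2) * L.+1%:R) ->
  exists2 om : nat -> {perm T}, (forall r, om r \in Gd) &
    forall e, e \in E -> (\sum_(r < N) appears I J om r e <= L.+1)%N.
Proof.
move=> sys uE et0 et1 hG hN.
have q0 : 0 <= q by rewrite divr_ge0 // exprn_ge0.
have et10 : 0 < 1 - et by rewrite subr_gt0.
have P0 : 0 < #|[set: {perm T}]|%:R :> R.
  by rewrite ltr0n; apply/card_gt0P; exists 1%g; rewrite inE.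
have G0 : (0 < #|Gd|)%N by rewrite -(ltr0n R); apply: lt_le_trans hG; rewrite mulr_gt0.
pose inc (w : {perm T}) (e : {set T}) := [exists p : V * V, w @: (I p.1 :|: J p.2) == e].
have freq e : e \in E -> \sum_(w in Gd) (inc w e)%:R <= q / (1 - et) * #|Gd|%:R.
  move=> eE; apply: (@le_trans _ _ (#|[set: {perm T}]|%:R * q)).
    rewrite -(edge_frequency sys (uE e eE)) big_mkcond; apply: ler_sum => w _.
    have S0 : 0 <= \sum_(p : V * V) (w @: (I p.1 :|: J p.2) == e)%:R :> R by apply: sumr_ge0.
    case: (w \in Gd) => //; case: (boolP (inc w e)) => [/existsP[p pe]|_] //.
    by rewrite (bigD1 p) //= pe lerDl sumr_ge0.
  rewrite mulrAC ler_pdivlMr // [_ * q]mulrC -mulrA.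
  by rewrite ler_wpM2l // mulrC.
have q10 : 0 <= q / (1 - et) by rewrite divr_ge0 // ltW.
have [om omG hom] := greedy_selection (ltW et0) q10 G0 freq N.
exists om => // e eE; rewrite leqNgt; apply/negP => lt.
have up : \sum_(e in E) (1 + et) ^+ (\sum_(r < N) inc (om r) e) <= exp ((et - et ^+ 2) * L.+1%:R).
  apply: le_trans hom (le_trans _ hN); rewrite ler_wpM2l //.
  have -> : exp (et * (q / (1 - et)) * N%:R) = exp (et * (q / (1 - et))) ^+ N.
    by rewrite expRX mulr_natr.
  have t0 : 0 <= et * (q / (1 - et)) by rewrite mulr_ge0 // ltW.
  by apply: lerXn2r; rewrite ?nnegrE ?addr_ge0 ?(ltW (exp_gt0 _)) ?exp_ge1Dx.
have : exp ((et - et ^+ 2) * L.+1%:R) < \sum_(e in E) (1 + et) ^+ (\sum_(r < N) inc (om r) e).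
  apply: (@lt_le_trans _ _ ((1 + et) ^+ L.+2)).
    have -> : exp ((et - et ^+ 2) * L.+1%:R) = exp (et - et ^+ 2) ^+ L.+1.
      by rewrite expRX mulr_natr.
    apply: (@le_lt_trans _ _ ((1 + et) ^+ L.+1)).
      by apply: lerXn2r; rewrite ?nnegrE ?addr_ge0 ?(ltW et0) ?(ltW (exp_gt0 _)) ?exp_le_1D ?(ltW et0).
    by rewrite ltr_eXn2l // ltrDl.
  rewrite (bigD1 e) //= -[leLHS]addr0 lerD //.
    by rewrite ler_weXn2l // lerDl ltW.
  by apply: sumr_ge0 => e' _; rewrite exprn_ge0 // addr_ge0 // ltW.
by rewrite ltNge up.
Qed.
End Assembly.

Section SplitArith.
Local Open Scope ring_scope.
Variables (et i P : R).

(** Permutations lose [2 * et] and colouring [4 * et]; the second-order term of the upper bound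
    raises 6 to 7, and the same 7 is used on both sides. *)
Lemma split_arith_lo lo : 0 <= i -> 0 <= P -> 0 <= et -> et <= 1 / 4 ->
  (1 - 2 * et) * P <= lo -> (1 - 7 * et) * (i * P) <= (1 - 4 * et) * (i * lo).
Proof.
move=> i0 P0 et0 et4 h.
have h1 : 0 <= (1 - 4 * et) * i * (lo - (1 - 2 * et) * P).
  by apply: mulr_ge0; [apply: mulr_ge0 => // | ]; lra.
have iP0 : 0 <= i * P by apply: mulr_ge0.
have h2 : 0 <= (et + 8 * et ^+ 2) * (i * P).
  by apply: mulr_ge0 => //; apply: addr_ge0 => //; apply: mulr_ge0 => //; apply: sqr_ge0.
by lra.
Qed.

Lemma split_arith_hi hi : 0 <= i -> 0 <= P -> 0 <= et -> et <= 1 / 8 ->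
  hi <= (1 + 2 * et) * P -> (1 + 4 * et) * (i * hi) <= (1 + 7 * et) * (i * P).
Proof.
move=> i0 P0 et0 et8 h.
have h1 : 0 <= (1 + 4 * et) * i * ((1 + 2 * et) * P - hi).
  by apply: mulr_ge0; [apply: mulr_ge0 => // | ]; lra.
have iP0 : 0 <= i * P by apply: mulr_ge0.
have h2 : 0 <= et * (1 - 8 * et) * (i * P).
  by apply: mulr_ge0 => //; apply: mulr_ge0 => //; lra.
by lra.
Qed.

(** [(1 - 4 * et) * (1 - 169 * et)] is at least [1 - 173 * et], within the allowance of
    [200 * et]. *)
Lemma count_arith q N r : 0 <= P -> 0 <= i -> 0 <= et -> et <= 1 / 169 ->
  (1 - 4 * et) * i <= N * q -> (1 - 169 * et) * P <= r ->
  (1 - 4 * (50 * et)) * (i * P) <= N * r * q.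
Proof.
move=> P0 i0 et0 et1 hN hr.
have h1 : (1 - 4 * et) * i * ((1 - 169 * et) * P) <= N * q * r.
  by apply: ler_pM => //; apply: mulr_ge0 => //; lra.
have iP0 : 0 <= i * P by apply: mulr_ge0.
have h2 : 0 <= et * (i * P) by apply: mulr_ge0.
have h3 : 0 <= et * (et * (i * P)) by apply: mulr_ge0.
by lra.
Qed.

Lemma count_field (c p C nu k : R) : k != 0 -> nu != 0 -> C != 0 ->
  c * (p * C) / (k * nu / k) = c * (p * nu) / (nu ^+ 2 / C).
Proof. by move=> *; field; apply/and3P. Qed.
End SplitArith.

(** * The packing theorem for one hypergraph with explicit bounds *)

Section MainFinite.
Local Open Scope ring_scope.
Variables (a b v n : nat) (E : {set {set 'I_n}}) (p e th l : R).
Hypothesis a0 : (0 < a)%N.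
Hypothesis b0 : (0 < b)%N.
Hypothesis v0 : (0 < v)%N.
Hypothesis nE : n = ((a + b) * v)%N.
Hypothesis uE : uniform (a + b) E.
Hypothesis pE : p = #|E|%:R / 'C(n, a + b)%:R.
Hypothesis deg_a : forall S : {set 'I_n}, #|S| = a ->
  (1 - e) * 'C(n - a, b)%:R * p <= (deg (a + b) E S)%:R.
Hypothesis deg_b : forall S : {set 'I_n}, #|S| = b ->
  (1 - e) * 'C(n - b, a)%:R * p <= (deg (a + b) E S)%:R.
Hypothesis codeg_a : forall S1 S2 : {set 'I_n}, #|S1| = a -> #|S2| = a ->
  [disjoint S1 & S2] ->
  (#|nbhd (a + b) E S1 :&: nbhd (a + b) E S2|)%:R
    <= (1 + e) * 'C(n - 2 * a, b)%:R * p ^+ 2.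
Hypothesis p_gt0 : 0 < p.
Hypothesis th0 : 0 < th.
Hypothesis th28 : th <= 1 / 28.
Hypothesis eE : e = th ^+ 3.
Hypothesis l1 : 1 <= l.
Hypothesis lE : exp l = n%:R.

Let k : R := (a + b)%:R.
Let et : R := th / 50.
Let nu : R := v%:R.

Hypothesis big : 64 * k ^+ 3 * (k + 5) * l ^+ 10 <= et ^+ 6 * n%:R * p ^+ 4.

Let k2 : 2 <= k. Proof. by rewrite /k ler_nat; lia. Qed.
Let ab2 : (1 < a + b)%N. Proof. by rewrite -(addn1 1) leq_add. Qed.
Let n0 : (0 < n)%N. Proof. by rewrite nE muln_gt0 v0 andbT; lia. Qed.
Let nR0 : 0 < n%:R :> R. Proof. by rewrite ltr0n. Qed.
Let nu0 : 0 < nu. Proof. by rewrite ltr0n. Qed.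
Let nkv : n%:R = k * nu. Proof. by rewrite nE natrM. Qed.
Let kn : (a + b <= n)%N. Proof. by rewrite nE leq_pmulr. Qed.
Let C0 : 0 < 'C(n, a + b)%:R :> R. Proof. by rewrite ltr0n bin_gt0. Qed.
Let et0 : 0 < et. Proof. by rewrite divr_gt0. Qed.
Let et1400 : et <= 1 / 1400.
Proof. by have h := th28; rewrite /et; lra. Qed.
Let et1 : et <= 1. Proof. by have h := et1400; lra. Qed.
Let l0 : 0 < l. Proof. exact: lt_le_trans l1. Qed.

Let p1 : p <= 1.
Proof.
rewrite pE ler_pdivrMr // mul1r ler_nat.
have -> : 'C(n, a + b) = #|[set A : {set 'I_n} | #|A| == (a + b)%N]|.
  by rewrite card_draws card_ord.
by apply: subset_leq_card; apply/subsetP => A /uE; rewrite inE => ->.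
Qed.

Let q : R := nu ^+ 2 / 'C(n, a + b)%:R.
Let q0 : 0 < q. Proof. by rewrite divr_gt0 // exprn_gt0. Qed.
(** One absolute deviation for all events: a proportion [et] of the typical codegree, and at most
    that of the typical degree since [p ^+ 2 <= p]. *)
Let x : R := et * p ^+ 2 * nu.
Let lo : R := (1 - e) * p * nu - x.
Let hi : R := (1 + e) * p ^+ 2 * nu + x.

Let e_et : e <= et. Proof. by rewrite eE; apply: num_eps_le_eta. Qed.
Let e0 : 0 < e. Proof. by rewrite eE exprn_gt0. Qed.
Let p2p : p ^+ 2 <= p.
Proof. by rewrite expr2 -[leRHS]mulr1 ler_wpM2l // ltW. Qed.

Let lo_ge : (1 - 2 * et) * (p * nu) <= lo.
Proof.
have h1 : 0 <= (et - e) * (p * nu) by rewrite mulr_ge0 ?subr_ge0 // mulr_ge0 // ltW.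
have h2 : 0 <= et * nu * (p - p ^+ 2) by rewrite mulr_ge0 ?subr_ge0 // mulr_ge0 // ltW.
by rewrite /lo /x; lra.
Qed.

Let hi_le : hi <= (1 + 2 * et) * (p ^+ 2 * nu).
Proof.
have h1 : 0 <= (et - e) * (p ^+ 2 * nu).
  by rewrite mulr_ge0 ?subr_ge0 // mulr_ge0 ?exprn_ge0 // ltW.
by rewrite /hi /x; lra.
Qed.

Let hi_ge : p ^+ 2 * nu <= hi.
Proof.
have h1 : 0 <= (et + e) * (p ^+ 2 * nu).
  apply: mulr_ge0; first by apply: addr_ge0; apply: ltW.
  by rewrite mulr_ge0 ?exprn_ge0 // ltW.
by rewrite /hi /x; lra.
Qed.

Let events : 2 * nu + nu ^+ 2 <= n%:R ^+ 2.
Proof.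
have h1 : 1 <= nu by rewrite ler1n.
have h2 := k2; rewrite nkv.
have : 0 <= (k - 2) * nu by rewrite mulr_ge0 ?subr_ge0 // ltW.
have : 0 <= (nu - 1) * nu by rewrite mulr_ge0 ?subr_ge0 // ltW.
have h3 : 2 * nu <= k * nu by rewrite ler_pM2r.
have : (2 * nu) ^+ 2 <= (k * nu) ^+ 2.
  by apply: lerXn2r => //; rewrite nnegrE mulr_ge0 // ltW // (lt_le_trans _ k2).
by rewrite !expr2; lra.
Qed.

(** [x / (64 * n%:R)] minimises the exponent, with value [- x ^+ 2 / (128 * n%:R)]. This is at most
    [- 4 * l], so each event has probability at most [n ^ -4], against at most [n ^ 2] events. *)
Let perm_bad : (2 * nu + nu ^+ 2) *
  exp (32 * (x / (64 * n%:R)) ^+ 2 * n%:R - x / (64 * n%:R) * x) <= et.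
Proof.
have ln := num_perm_tail k2 nR0 l1 p_gt0 et0 et1 big.
have en := num_eta_n k2 nR0 l1 p_gt0 p1 et0 et1 big.
have -> : 32 * (x / (64 * n%:R)) ^+ 2 * n%:R - x / (64 * n%:R) * x =
    - (x ^+ 2 / (128 * n%:R)) by field; rewrite lt0r_neq0.
have h4 : 4 * l <= x ^+ 2 / (128 * n%:R).
  rewrite ler_pdivlMr ?mulr_gt0 //.
  have kk : 0 < k ^+ 2 by rewrite exprn_gt0 // (lt_le_trans _ k2).
  rewrite -(ler_pM2l kk).
  have -> : k ^+ 2 * x ^+ 2 = et ^+ 2 * n%:R * p ^+ 4 * n%:R.
    by rewrite nkv /x; ring.
  have -> : k ^+ 2 * (4 * l * (128 * n%:R)) = 512 * k ^+ 2 * l * n%:R by ring.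
  by rewrite ler_pM2r.
apply: (@le_trans _ _ (n%:R ^+ 2 * exp (- (4 * l)))).
  apply: ler_pM events _; rewrite ?addr_ge0 ?mulr_ge0 ?exprn_ge0 ?(ltW nu0) //.
    exact/ltW/exp_gt0.
  by rewrite ler_exp // lerN2.
have -> : exp (- (4 * l)) = (n%:R ^+ 4)^-1.
  have h : exp (- (4 * l)) * exp (4 * l) = 1 by rewrite -expD addNr expR0.
  have e4 : exp (4 * l) = n%:R ^+ 4 by rewrite -lE expRX mulr_natl.
  by rewrite -e4; apply/esym/mulr1_eq; rewrite mulrC.
rewrite ler_pdivrMr ?exprn_gt0 //.
have n1 : 1 <= n%:R :> R by rewrite ler1n.
have -> : et * n%:R ^+ 4 = et * n%:R * n%:R * n%:R ^+ 2 by ring.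
by rewrite -[leLHS]mul1r ler_wpM2r ?exprn_ge0 // mulr_ege1.
Qed.

(** With [N * q <= (1 - 3 * et) * Lp], the two exponents of the selection step differ by at least
    [et ^+ 2 * Lp / 2]; this gap must absorb [k * l], the logarithm of the bound on the number of
    edges. *)
Let Lr : R := 2 * k * l / et ^+ 2.
Let L : nat := Num.truncn Lr.
Let Lp : R := L.+1%:R.

Let Lr_ge : 1 / et <= Lr.
Proof.
rewrite /Lr ler_pdivlMr ?exprn_gt0 // expr2 mulrA mul1r mulVf ?lt0r_neq0 // mul1r.
have : 0 <= (k - 2) * l by rewrite mulr_ge0 ?subr_ge0 // ltW.
by have := et1; have := l1; lra.
Qed.

Let Lp_ge : Lr <= Lp.
Proof.
have Lr0 : 0 <= Lr by rewrite (le_trans _ Lr_ge) // divr_ge0 // ltW.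
by rewrite /Lp /L; have /andP[_ /ltW] := truncn_itv Lr0.
Qed.

Let Lp_le : Lp <= 4 * k * l / et ^+ 2.
Proof.
have Lr0 : 0 <= Lr by rewrite (le_trans _ Lr_ge) // divr_ge0 // ltW.
have /andP[h _] := truncn_itv Lr0.
have L1 : 1 <= Lr by apply: le_trans Lr_ge; rewrite ler_pdivlMr // mul1r.
have -> : 4 * k * l / et ^+ 2 = 2 * Lr by rewrite /Lr; ring.
by rewrite /Lp -natr1 /L; lra.
Qed.

Let Lp0 : 0 < Lp. Proof. by rewrite ltr0n. Qed.

Let D : R := Lp^-1 * (p * nu).

Let tail_num : (k + 5) * l <= et ^+ 2 * p ^+ 2 * nu / Lp ^+ 2.
Proof.
have -> : nu = n%:R / k by rewrite nkv mulrC mulKf // lt0r_neq0 // (lt_le_trans _ k2).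
by apply: num_colour_tail Lp0 Lp_le => //; exact: big.
Qed.

Let pLp : p / Lp <= 1.
Proof. by rewrite ler_pdivrMr // mul1r (le_trans p1) // ler1n. Qed.

Let D_large : 1 <= et ^+ 2 * D.
Proof.
have h1 : 1 <= (k + 5) * l.
  by apply: mulr_ege1 => //; have h := k2; lra.
apply: le_trans h1 (le_trans tail_num _).
have -> : et ^+ 2 * p ^+ 2 * nu / Lp ^+ 2 = et ^+ 2 * D * (p / Lp).
  by rewrite /D [Lp ^+ 2]expr2 invfM; ring.
rewrite -[leRHS]mulr1 ler_wpM2l // mulr_ge0 ?exprn_ge0 ?(ltW et0) //.
by rewrite mulr_ge0 ?invr_ge0 ?mulr_ge0 // ltW.
Qed.

(** 168 is [24 * 7], from the cut estimate with error [7 * et]. Each rounding costs at most one more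
    [et], because [q <= 1 <= et * Lp] and [1 <= et ^+ 2 * D]. *)
Let N : nat := Num.truncn ((1 - 3 * et) * Lp / q).
Let r0 : nat := Num.truncn ((1 - 168 * et) * D).

Let N_le : N%:R * q <= (1 - 3 * et) * Lp.
Proof.
have h0 : 0 <= (1 - 3 * et) * Lp / q.
  rewrite divr_ge0 ?(ltW q0) // mulr_ge0 ?(ltW Lp0) //.
  by have h := et1400; lra.
by have /andP[h _] := truncn_itv h0; rewrite -ler_pdivlMr.
Qed.

Let N_ge : q <= 1 -> (1 - 4 * et) * Lp <= N%:R * q.
Proof.
move=> q1; have h0 : 0 <= (1 - 3 * et) * Lp / q.
  rewrite divr_ge0 ?(ltW q0) // mulr_ge0 ?(ltW Lp0) //.
  by have h := et1400; lra.
have h : (1 - 3 * et) * Lp < N%:R * q + q.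
  have /andP[_] := truncn_itv h0.
  by rewrite ltr_pdivrMr // -[X in _ < X * _]natr1 [X in _ < X]mulrDl mul1r.
have := le_trans Lr_ge Lp_ge; rewrite ler_pdivrMr // => h2.
by lra.
Qed.

Let r0_le : r0%:R <= (1 - 24 * (7 * et)) * D.
Proof.
have D0 : 0 <= D by rewrite mulr_ge0 ?invr_ge0 ?mulr_ge0 // ltW.
have h0 : 0 <= (1 - 168 * et) * D by rewrite mulr_ge0 //; have h := et1400; lra.
have /andP[h _] := truncn_itv h0.
have -> : 24 * (7 * et) = 168 * et by ring.
exact: h.
Qed.

Let r0_ge : (1 - 169 * et) * D <= r0%:R.
Proof.
have D0 : 0 <= D by rewrite mulr_ge0 ?invr_ge0 ?mulr_ge0 // ltW.
have h0 : 0 <= (1 - 168 * et) * D by rewrite mulr_ge0 //; have h := et1400; lra.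
have h : (1 - 168 * et) * D < r0%:R + 1.
  by have /andP[_] := truncn_itv h0; rewrite -[X in _ < X -> _]natr1.
have : et ^+ 2 * D <= et * D.
  by rewrite ler_wpM2r // expr2 -[leRHS]mulr1 ler_wpM2l // ltW.
by have h2 := D_large; lra.
Qed.

Let E_le : #|E|%:R <= exp (k * l).
Proof.
have -> : exp (k * l) = n%:R ^+ (a + b) by rewrite -lE expRX mulr_natl.
rewrite -natrX ler_nat; apply: leq_trans (leq_bin_expn n (a + b)).
have -> : 'C(n, a + b) = #|[set A : {set 'I_n} | #|A| == (a + b)%N]|.
  by rewrite card_draws card_ord.
by apply: subset_leq_card; apply/subsetP => A /uE; rewrite inE => ->.
Qed.

Let selection_num : #|E|%:R * exp (et * (q / (1 - et)) * N%:R) <= exp ((et - et ^+ 2) * Lp).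
Proof.
apply: (@le_trans _ _ (exp (k * l) * exp (et * (q / (1 - et)) * N%:R))).
  by rewrite ler_wpM2r // ltW // exp_gt0.
rewrite -expD ler_exp //.
have h := et1400; have e10 : 0 < 1 - et by lra.
have kl : k * l <= et ^+ 2 * Lp / 2.
  have := Lp_ge; rewrite /Lr ler_pdivrMr ?exprn_gt0 //; lra.
have h2 : et * (q / (1 - et)) * N%:R <= et * ((1 - 3 * et) * Lp / (1 - et)).
  have -> : et * (q / (1 - et)) * N%:R = et * (N%:R * q / (1 - et)) by ring.
  by rewrite ler_pM2l // ler_pM2r ?invr_gt0.
have h3 : (1 - 3 * et) * Lp / (1 - et) <= (1 - 3 / 2 * et) * Lp.
  rewrite ler_pdivrMr //.
  have : 0 <= Lp * (et * (1 / 2 + 3 / 2 * et)).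
    apply: mulr_ge0; [exact: ltW | apply: mulr_ge0; first exact: ltW].
    by have h3 := et0; lra.
  by lra.
have h4 : et * ((1 - 3 * et) * Lp / (1 - et)) <= et * ((1 - 3 / 2 * et) * Lp).
  by rewrite ler_pM2l.
have : 0 <= et ^+ 2 * Lp by rewrite mulr_ge0 ?sqr_ge0 // ltW.
by rewrite expr2 in kl *; lra.
Qed.

(** This is [n] to the power [- (k + 5)]. It must beat [N], at most [n] to the [k + 1], times at
    most [n ^ 2] events per graph. *)
Let be : R := exp (- ((k + 5) * l)).

Let colour_tail y : p ^+ 2 * nu <= 2 * Lp ^+ 2 * y -> exp (- (2 * et ^+ 2 * y)) <= be.
Proof.
move=> h; rewrite ler_exp // lerN2 (le_trans tail_num) //.
rewrite ler_pdivrMr ?exprn_gt0 //.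
have := ler_wpM2l (sqr_ge0 et) h; lra.
Qed.

Let colour_tail_lo : exp (- (2 * et ^+ 2 * (Lp^-1 * lo))) <= be.
Proof.
apply: colour_tail.
have -> : 2 * Lp ^+ 2 * (Lp^-1 * lo) = Lp * (2 * lo).
  by rewrite expr2 !mulrA -(mulrA _ Lp Lp^-1) mulfV ?lt0r_neq0 //; ring.
have Lp1 : 1 <= Lp by rewrite ler1n.
have h1 : p * nu <= 2 * lo.
  have : 0 <= (1 - 4 * et) * (p * nu).
    by rewrite mulr_ge0 ?mulr_ge0 ?(ltW p_gt0) ?(ltW nu0) //; have h := et1400; lra.
  by have h2 := lo_ge; lra.
have h0 : 0 <= p * nu by rewrite mulr_ge0 // ltW.
apply: (@le_trans _ _ (p * nu)); first by rewrite ler_pM2r.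
by rewrite (le_trans h1) // ler_peMl // (le_trans h0 h1).
Qed.

Let colour_tail_hi : exp (- (2 * et ^+ 2 * (Lp ^- 2 * hi))) <= be.
Proof.
apply: colour_tail.
have -> : 2 * Lp ^+ 2 * (Lp ^- 2 * hi) = 2 * hi.
  by rewrite -mulrA (mulrA _ _ hi) mulfV ?mul1r // expf_neq0 // lt0r_neq0.
have h0 : 0 <= p ^+ 2 * nu by rewrite mulr_ge0 ?sqr_ge0 // ltW.
by have := hi_ge; lra.
Qed.

Let few_events : N%:R * ((2 * nu + nu ^+ 2) * be) < 1.
Proof.
have NL : N%:R <= n%:R * n%:R ^+ (a + b) :> R.
  have qC : 1 <= q * n%:R ^+ (a + b).
    rewrite /q mulrAC ler_pdivlMr // mul1r -[leLHS]mul1r ler_pM //.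
      by rewrite exprn_ege1 // ler1n.
    by rewrite -natrX ler_nat leq_bin_expn.
  have h1 : N%:R * q <= n%:R.
    apply: le_trans N_le _; apply: le_trans (le_trans Lp_le _); last first.
      exact: num_colours k2 nR0 l1 p_gt0 p1 et0 et1 big.
    rewrite -[leRHS]mul1r ler_pM2r //; have h := et0; lra.
  apply: (@le_trans _ _ (N%:R * q * n%:R ^+ (a + b))).
    by rewrite -mulrA ler_peMr.
  by rewrite ler_wpM2r // exprn_ge0.
have beE : be = (n%:R ^+ (a + b + 5))^-1.
  have h : exp ((k + 5) * l) = n%:R ^+ (a + b + 5).
    by rewrite -lE expRX; congr (exp _); rewrite -[RHS]mulr_natl natrD.
  by rewrite /be -h; apply/esym/mulr1_eq; rewrite -expD subrr expR0.
rewrite beE mulrA ltr_pdivrMr ?exprn_gt0 // mul1r.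
apply: (@le_lt_trans _ _ (n%:R * n%:R ^+ (a + b) * n%:R ^+ 2)).
  by rewrite ler_pM // addr_ge0 ?mulr_ge0 ?sqr_ge0 // ltW.
have -> : n%:R * n%:R ^+ (a + b) * n%:R ^+ 2 = n%:R ^+ (a + b + 3) :> R by rewrite [RHS]exprD; ring.
have n2 : 1 < n%:R :> R by rewrite ltr1n; apply: leq_trans kn; apply: ab2.
by rewrite ltr_eXn2l // ltn_add2l.
Qed.

Let split_lo : (1 - 7 * et) * D <= (1 - 4 * et) * (Lp^-1 * lo).
Proof.
apply: split_arith_lo lo_ge; rewrite ?invr_ge0 ?ler0n ?(ltW et0) //.
  by apply: mulr_ge0; apply: ltW.
by have h := et1400; lra.
Qed.

Let split_hi : (1 + 4 * et) * (Lp ^- 2 * hi) <= (1 + 7 * et) * D ^+ 2 / nu.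
Proof.
have -> : (1 + 7 * et) * D ^+ 2 / nu = (1 + 7 * et) * (Lp ^- 2 * (p ^+ 2 * nu)).
  have -> : D ^+ 2 = Lp ^- 2 * (p ^+ 2 * nu) * nu by rewrite /D !exprMn exprVn; ring.
  by rewrite mulrA mulfK // lt0r_neq0.
apply: split_arith_hi hi_le; rewrite ?invr_ge0 ?exprn_ge0 ?ler0n ?(ltW et0) //.
  by apply: mulr_ge0; [exact: sqr_ge0 | exact: ltW].
by have h := et1400; lra.
Qed.

Let final_count : q <= 1 -> (1 - 4 * th) * #|E|%:R / (n%:R / k) <= N%:R * r0%:R.
Proof.
move=> q1; have kn0 : k != 0 by rewrite lt0r_neq0 // (lt_le_trans _ k2).
have -> : (1 - 4 * th) * #|E|%:R / (n%:R / k) = (1 - 4 * th) * (p * nu) / q.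
  have -> : #|E|%:R = p * 'C(n, a + b)%:R by rewrite pE divfK // lt0r_neq0.
  by rewrite nkv; apply: count_field => //; apply: lt0r_neq0.
have thE : th = 50 * et by rewrite /et; lra.
have -> : p * nu = Lp * D by rewrite /D mulrA mulfV ?mul1r // lt0r_neq0.
rewrite ler_pdivrMr // {1}thE; apply: count_arith; rewrite ?(ltW et0) ?(ltW Lp0) ?N_ge ?r0_ge //.
  apply: mulr_ge0; first by rewrite invr_ge0 ltW.
  by apply: mulr_ge0; apply: ltW.
by have h := et1400; lra.
Qed.

Lemma near_perfect_packing : exists F : {set {set {set 'I_n}}},
  [/\ forall M, M \in F -> perfect_matching (a + b) E M,
      forall M1 M2, M1 \in F -> M2 \in F -> M1 != M2 -> [disjoint M1 & M2] &
      (1 - 4 * th) * #|E|%:R / (n%:R / k) <= #|F|%:R].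
Proof.
have [I [J sys]] := block_system_ord nE.
have cV : #|'I_v|%:R = nu by rewrite card_ord.
have x0 : 0 <= x.
  apply: mulr_ge0; last exact: ltW.
  by apply: mulr_ge0; [exact: ltW | exact: sqr_ge0].
pose la : R := x / (64 * n%:R).
have la0 : 0 <= la by apply: divr_ge0 => //; apply: mulr_ge0; rewrite ?ler0n.
have la8 : la <= 1 / 8.
  rewrite ler_pdivrMr ?mulr_gt0 //.
  have xnu : x <= nu.
    rewrite /x -[leRHS]mul1r ler_pM2r //; apply: mulr_ile1; rewrite ?sqr_ge0 ?(ltW et0) //.
    exact: le_trans p2p p1.
  have : nu <= n%:R by rewrite ler_nat nE leq_pmull // ltnW.
  by lra.
pose Gd := [set s | well_spread (bip_of E I J s) lo hi].
have hG : (1 - et) * #|[set: {perm 'I_n}]|%:R <= #|Gd|%:R.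
  have bad := few_bad_perms x uE sys kn deg_a deg_b codeg_a la0 la8.
  rewrite cV -/lo -/hi in bad.
  have split_P : #|[set: {perm 'I_n}]|%:R = #|Gd|%:R +
      \sum_(s : {perm 'I_n}) (~~ well_spread (bip_of E I J s) lo hi)%:R :> R.
    rewrite cardsT -!sum1_card !natr_sum big_mkcond [X in _ = X + _]big_mkcond -big_split /=.
    by apply: eq_bigr => s _; rewrite inE; case: (well_spread _ _ _); rewrite ?addr0 ?add0r.
  have bad_le : (2 * nu + nu ^+ 2) * (#|[set: {perm 'I_n}]|%:R *
      exp (32 * la ^+ 2 * n%:R - la * x)) <= et * #|[set: {perm 'I_n}]|%:R.
    by rewrite mulrCA mulrC ler_wpM2r.
  by rewrite mulrBl mul1r lerBlDr {1}split_P lerD2l (le_trans bad).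
have q1 : q <= 1.
  rewrite ler_pdivrMr // mul1r -natrX ler_nat.
  by have := block_count_le sys a0 b0; rewrite !card_ord.
have et_lt1 : et < 1 by have h := et1400; lra.
have [om omG cover] : exists2 om : nat -> {perm 'I_n}, (forall r, om r \in Gd) &
    forall e, e \in E -> (\sum_(r < N) appears I J om r e <= L.+1)%N.
  by apply: selected_perms sys uE et0 et_lt1 hG _; rewrite cV !card_ord.
have om_good r : well_spread (bip_of E I J (om r)) lo hi by have := omG r; rewrite inE.
have et4 : et <= 1 / 4 by have h := et1400; lra.
have few : N%:R * ((2 * #|'I_v|%:R + #|'I_v|%:R ^+ 2) * be) < 1 by rewrite cV.
have [G [GB Gdis Gws]] := colour_split sys a0 b0 (ltW et0) et4 om_good cover
  colour_tail_lo colour_tail_hi few.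
have nE' : n = ((a + b) * #|[set: 'I_v]|)%N by rewrite cardsT card_ord.
have Gc r : (r < N)%N -> bip_cond r0 (G r).
  move=> rN; have /and3P[/forallP gl /forallP gr /forallP gc] := Gws r rN.
  have cVT : #|[set: 'I_v]|%:R = nu by rewrite cardsT card_ord.
  (* The cut estimate requires [7 * et <= 1 / 200]; this is the reason for [th <= 1 / 28]. *)
  apply: (@bip_cond_mixing R _ (G r) D (7 * et) _ _ _ _ _ _ _ r0 r0_le).
  - by rewrite cVT.
  - by rewrite mulr_gt0.
  - by have h := et1400; lra.
  - have D0 : 0 <= et ^+ 2 * D by apply: le_trans D_large.
    by have h := D_large; rewrite exprMn; lra.
  - by move=> y; apply: le_trans split_lo (gl y).
  - by move=> y; apply: le_trans split_lo (gr y).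
  move=> y y' yy'; rewrite cVT; apply: le_trans split_hi.
  by have /forallP/(_ y') := gc y; rewrite yy'.
have [F [Fpm Fdis cF]] := packing sys a0 b0 nE' n0 GB Gdis Gc.
by exists F; split => //; rewrite cF natrM; apply: final_count.
Qed.
End MainFinite.

(** * Asymptotic statement *)

Lemma Rceil_le_nat (d : nat) (x : R) : Z.ge (Z.of_nat d) (Rceil x) -> (x <= d%:R)%R.
Proof.
move=> /Z.ge_le/IZR_le; rewrite -INR_IZR_INZ INRE opp_IZR => /RleP.
rewrite RoppE => h; apply: le_trans h; rewrite lerNr -RoppE; apply/RleP.
exact: (proj1 (base_Int_part _)).
Qed.

Lemma nat_le_Rfloor (d : nat) (x : R) : Z.le (Z.of_nat d) (Rfloor x) -> (d%:R <= x)%R.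
Proof.
move=> /IZR_le; rewrite -INR_IZR_INZ INRE => /RleP h; apply: le_trans h _.
by apply/RleP; exact: (proj1 (base_Int_part _)).
Qed.

Lemma exp_ln_nat (n : nat) : 0 < n -> exp (ln n%:R%R) = (n%:R)%R.
Proof. by move=> n0; rewrite exp_ln //; apply/RltP; rewrite R0E ltr0n. Qed.

Lemma ln_nat_ge1 (n : nat) : 3 <= n -> (1 <= ln n%:R%R)%R.
Proof.
move=> n3; rewrite leNgt; apply/negP => /RltP/exp_increasing/RltP.
rewrite exp_ln_nat ?(leq_trans _ n3) // => lt.
have e3 : (exp 1 <= 3%:R)%R by have := exp_le_3; rewrite IZRposE INRE => /RleP.
by have := lt_le_trans lt e3; rewrite ltr_nat ltnNge n3.
Qed.

Lemma Rpower_third_cube (e : R) : (0 < e)%R ->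
  (Rpower e (Rdiv (IZR 1) (IZR 3)) ^+ 3)%R = e.
Proof.
move=> /RltP e0; rewrite -RpowE -Rpower_pow; last exact: exp_pos.
rewrite Rpower_mult (_ : Rmult _ _ = IZR 1) ?Rpower_1 //.
have -> : IZR 3 = INR 3 by rewrite INR_IZR_INZ.
by rewrite /Rdiv Rmult_assoc Rinv_l ?Rmult_1_r //; apply: not_0_INR.
Qed.

Lemma Rpower_gt0 (e y : R) : (0 < Rpower e y)%R.
Proof. by apply/RltP; exact: exp_pos. Qed.

Section Bridge.
Local Open Scope ring_scope.

(** [s] is the square root of [n], removed by squaring; [M >= 1] reduces [M ^+ 2] to [M].
    Convergence of [e] to 0 says nothing about its sign: positivity is read off from the ratio
    exceeding [M]. *)
Lemma growth_bound (M e s p l n : R) : 1 <= M -> 0 < l -> 0 <= s -> s ^+ 2 = n -> 0 <= p ->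
  M < e * s * p ^+ 2 / l ^+ 5 ->
  [/\ 0 < e, 0 < p & M * l ^+ 10 <= e ^+ 2 * n * p ^+ 4].
Proof.
move=> M1 l0 s0 sn p0; rewrite ltr_pdivlMr ?exprn_gt0 // => h.
have M0 : 0 < M by apply: lt_le_trans M1.
have lhs0 : 0 < M * l ^+ 5 by rewrite mulr_gt0 // exprn_gt0.
have rhs0 := lt_trans lhs0 h.
have sp0 : 0 <= s * p ^+ 2 by rewrite mulr_ge0 // sqr_ge0.
have e0 : 0 < e.
  by rewrite ltNge; apply: contraTN rhs0 => e0; rewrite -leNgt -mulrA mulr_le0_ge0.
split => //.
  rewrite lt_neqAle p0 andbT; apply: contraTneq rhs0 => <-.
  by rewrite expr0n mulr0 ltxx.
have -> : e ^+ 2 * n * p ^+ 4 = (e * s * p ^+ 2) ^+ 2 by rewrite -sn; ring.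
apply: (@le_trans _ _ ((M * l ^+ 5) ^+ 2)); last first.
  by apply: lerXn2r; rewrite ?nnegrE ?ltW.
have -> : (M * l ^+ 5) ^+ 2 = M * (M * l ^+ 10) by ring.
by rewrite ler_peMl // mulr_ge0 ?exprn_ge0 // ltW.
Qed.

(** [50 ^+ 6] undoes the scaling [et = th / 50]. The colour tail alone would need 16 in place of 64;
    the larger factor also dominates the [512 * k ^+ 2] of the permutation tail from [k = 2] on. *)
Definition growth_const (k : nat) : R := 50 ^+ 6 * (64 * k%:R ^+ 3 * (k%:R + 5)).

Lemma growth_const_ge1 (k : nat) : (2 <= k)%N -> 1 <= growth_const k.
Proof.
move=> k2; have k1 : 1 <= k%:R :> R by rewrite ler1n ltnW.
have k5 : 1 <= k%:R + 5 :> R by rewrite (le_trans k1) // lerDl.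
apply: mulr_ege1; first by rewrite exprn_ege1 // ler1n.
by apply: mulr_ege1 => //; apply: mulr_ege1; [rewrite ler1n | apply: exprn_ege1].
Qed.

Definition eps_bound : R := (1 / 28) ^+ 3.

Lemma eps_bound_gt0 : Rlt (IZR 0) eps_bound.
Proof. by apply/RltP; rewrite R0E /eps_bound exprn_gt0 // divr_gt0. Qed.

Lemma packing_large (k n : nat) (E : {set {set 'I_n}}) (p e : R) :
  (2 <= k)%N -> (3 <= n)%N -> (k %| n)%N -> uniform k E ->
  p = #|E|%:R / 'C(n, k)%:R -> 0 < p -> 0 < e -> e <= eps_bound ->
  growth_const k * ln n%:R ^+ 10 <= e ^+ 2 * n%:R * p ^+ 4 ->
  (forall S : {set 'I_n}, #|S| = k./2 ->
    (1 - e) * 'C(n - k./2, uphalf k)%:R * p <= (deg k E S)%:R) ->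
  (forall S : {set 'I_n}, #|S| = uphalf k ->
    (1 - e) * 'C(n - uphalf k, k./2)%:R * p <= (deg k E S)%:R) ->
  (forall S1 S2 : {set 'I_n}, #|S1| = k./2 -> #|S2| = k./2 -> [disjoint S1 & S2] ->
    #|nbhd k E S1 :&: nbhd k E S2|%:R <= (1 + e) * 'C(n - 2 * k./2, uphalf k)%:R * p ^+ 2) ->
  exists F : {set {set {set 'I_n}}},
    [/\ forall M, M \in F -> perfect_matching k E M,
        forall M1 M2, M1 \in F -> M2 \in F -> M1 != M2 -> [disjoint M1 & M2] &
        (1 - 4 * Rpower e (Rdiv (IZR 1) (IZR 3))) * #|E|%:R / (n%:R / k%:R) <= #|F|%:R].
Proof.
move=> k2 n3 kn uE pE p0 e0 e28 big Ra Rb Re.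
have kE : (k./2 + uphalf k)%N = k by rewrite uphalf_half addnCA addnn odd_double_half.
set th := Rpower _ _; have th0 : 0 < th by apply: Rpower_gt0.
have thE : e = th ^+ 3 by rewrite Rpower_third_cube.
have th28 : th <= 1 / 28.
  by rewrite -(ler_pXn2r (n := 3)) -?thE ?nnegrE ?(ltW th0) ?divr_ge0.
have a0 : (0 < k./2)%N by rewrite half_gt0.
have b0 : (0 < uphalf k)%N by rewrite uphalf_gt0 ltnW.
have n0 : (0 < n)%N by apply: leq_trans n3.
have v0 : (0 < n %/ k)%N by rewrite divn_gt0 ?(dvdn_leq n0 kn) // ltnW.
have nE : n = ((k./2 + uphalf k) * (n %/ k))%N by rewrite kE mulnC divnK.

have c0 : 0 < 50 ^+ 6 :> R by rewrite exprn_gt0.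
have big' : 64 * k%:R ^+ 3 * (k%:R + 5) * ln n%:R ^+ 10
    <= (th / 50) ^+ 6 * n%:R * p ^+ 4.
  rewrite -(ler_pM2l c0).
  have -> : 50 ^+ 6 * ((th / 50) ^+ 6 * n%:R * p ^+ 4) = e ^+ 2 * n%:R * p ^+ 4.
    by rewrite thE; field.
  by apply: le_trans big; rewrite /growth_const !mulrA.
have := @near_perfect_packing _ _ _ _ E p e th (ln n%:R) a0 b0 v0 nE.
rewrite !kE => packing_kE; apply: packing_kE => //; [exact: ln_nat_ge1 | exact: exp_ln_nat].
Qed.
End Bridge.

Unset Implicit Arguments.
Bind Scope R_scope with R.
Delimit Scope Z_scope with Z.
Delimit Scope R_scope with R.

Theorem theorem5 (k : nat) (p eps : nat -> R) :
  leq 2 k ->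
  cv0_mult k eps ->
  cvinf_mult k (fun n => eps n * sqrt (INR n) * (p n) ^ 2 / (ln (INR n)) ^ 5)%R ->
  exists N0 : nat, forall (n : nat) (E : {set {set 'I_n}}),
    leq N0 n -> (k %| n) ->
    uniform k E ->
    p n = (INR #|E| / INR 'C(n, k))%R ->
    let kX := k./2 in let kY := uphalf k in
    (* (R_a) *)
    (forall S : {set 'I_n}, #|S| = kX ->
       (Z.of_nat (deg k E S) >= Rceil ((1 - eps n) * INR 'C(n - kX, kY) * p n))%Z) ->
    (* (R_b) *)
    (forall S : {set 'I_n}, #|S| = kY ->
       (Z.of_nat (deg k E S) >= Rceil ((1 - eps n) * INR 'C(n - kY, kX) * p n))%Z) ->
    (* (R_c) *)
    (forall S : {set 'I_n}, #|S| = kX.+1 ->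
       (Z.of_nat (deg k E S) <= Rceil ((1 + eps n) * INR 'C(n - kX - 1, kY - 1) * p n))%Z) ->
    (* (R_d) *)
    (forall S : {set 'I_n}, #|S| = kY.+1 ->
       (Z.of_nat (deg k E S) <= Rceil ((1 + eps n) * INR 'C(n - kY - 1, kX - 1) * p n))%Z) ->
    (* (R_e) *)
    (forall S1 S2 : {set 'I_n}, #|S1| = kX -> #|S2| = kX -> [disjoint S1 & S2] ->
       (Z.of_nat #|nbhd k E S1 :&: nbhd k E S2|
          <= Rfloor ((1 + eps n) * INR 'C(n - 2 * kX, kY) * (p n) ^ 2))%Z) ->
    (* (R_f) *)
    (forall S1 S2 : {set 'I_n}, #|S1| = kY -> #|S2| = kY -> [disjoint S1 & S2] ->
       (Z.of_nat #|nbhd k E S1 :&: nbhd k E S2|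
          <= Rfloor ((1 + eps n) * INR 'C(n - 2 * kY, kX) * (p n) ^ 2))%Z) ->
    exists F : {set {set {set 'I_n}}},
      (forall M, M \in F -> perfect_matching k E M) /\
      (forall M1 M2, M1 \in F -> M2 \in F -> M1 != M2 -> [disjoint M1 & M2]) /\
      ((1 - 4 * Rpower (eps n) (1 / 3)) * INR #|E| / (INR n / INR k) <= INR #|F|)%R.
Proof.
move=> k2 eps0 epsinf.
have [N1 small] := eps0 _ eps_bound_gt0.
have [N2 grow] := epsinf (growth_const k).
(* From 3 on, [ln n] is at least 1, because [exp 1 <= 3]. *)
exists (maxn 3 (maxn N1 N2)) => n E; rewrite !geq_max => /and3P[n3 n1 n2] kn uE.
rewrite !RealsE => pE kX kY Ra Rb _ _ Re _.
have e_small : Order.le (eps n) eps_bound.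
  have /RltP := small n n1 kn; rewrite RabsE => /ltW; exact: le_trans (ler_norm _).
have n0 : 0 < n by apply: leq_trans n3.
have l0 := lt_le_trans ltr01 (ln_nat_ge1 n3).
have p0 := divr_ge0 (ler0n R #|E|) (ler0n R 'C(n, k)); rewrite -pE in p0.
have sn := sqr_sqrtr (ler0n R n).
have /RltP := grow n n2 kn; rewrite !RealsE => h.
have [e0 pn0 big] := growth_bound (growth_const_ge1 k2) l0 (sqrtr_ge0 _) sn p0 h.
have [|||F [Fpm Fdis Fcard]] := packing_large k2 n3 kn uE pE pn0 e0 e_small big.
- by move=> S /Ra/Rceil_le_nat; rewrite !RealsE.
- by move=> S /Rb/Rceil_le_nat; rewrite !RealsE.
- by move=> S1 S2 c1 c2 d; have := nat_le_Rfloor (Re S1 S2 c1 c2 d); rewrite !RealsE.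
exists F; split => //; split => //.
apply/RleP; rewrite !RealsE; move: Fcard; rewrite !RealsE.
by [].
Qed.
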